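(* Let $n,m\ge 1$ be integers. Let $(\mathbf{k}_t)_{t\ge 1}$ be a countable collection of $n$-tuples $\mathbf{k}_t=(k_{1,t},\ldots,k_{n,t})$ of positive real numbers satisfying $\sum_{i=1}^n k_{i,t}=1$ for every $t$. Let $\Theta\in\bigcap_{t\ge 1}\mathrm{Bad}(\mathbf{k}_t,n,m)$ and let $\mathcal{M}\subset\mathbb{R}^n$ be a non-degenerate $C^{(1)}$ submanifold of $\mathbb{R}^n$. Then $$\dim\Big(\bigcap_{t\ge 1}\mathrm{Bad}_\Theta(\mathbf{k}_t,n,m)\cap\mathcal{M}\Big)=\dim(\mathcal{M}),$$ where $\dim$ denotes Hausdorff dimension.
   Context: Notation: $|\cdot|$ is the supremum norm on $\mathbb{R}^m$; $\|\cdot\|$ is the distance from a real number to the nearest integer. For a real $n\times m$ matrix $\Theta=(\Theta_{ij})$ and $q\in\mathbb{Z}^m$, put $\Theta_i(q)=\sum_{j=1}^m q_j\Theta_{ij}$ for $1\le i\le n$. For an $n$-tuple $\mathbf{k}=(k_1,\ldots,k_n)$ of positive reals with sum $1$: $\mathrm{Bad}(\mathbf{k},n,m)$ is the set of $\Theta\in\mathrm{Mat}_{n\times m}(\mathbb{R})$ such that $\inf_{q\in\mathbb{Z}^m\setminus\{0\}}\max_{1\le i\le n}\big(|q|^{mk_i}\|\Theta_i(q)\|\big)>0$; and, for $\Theta\in\mathrm{Mat}_{n\times m}(\mathbb{R})$, $\mathrm{Bad}_\Theta(\mathbf{k},n,m)$ is the set of $x=(x_1,\ldots,x_n)\in\mathbb{R}^n$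 such that $\inf_{q\in\mathbb{Z}^m\setminus\{0\}}\max_{1\le i\le n}\big(|q|^{mk_i}\|\Theta_i(q)-x_i\|\big)>0$. A $C^{(1)}$ curve in $\mathbb{R}^n$ is a set $\mathcal{C}=\{(f_1(x),\ldots,f_n(x)):x\in I\}$ where $f=(f_1,\ldots,f_n):I\to\mathbb{R}^n$ is a $C^{(1)}$ map on a compact interval $I\subset\mathbb{R}$. It is non-degenerate if there is some $x\in I$ such that $f_i'(x)\neq 0$ for all $i=1,\ldots,n$. A $C^{(1)}$ submanifold of $\mathbb{R}^n$ is non-degenerate if it can be foliated by non-degenerate $C^{(1)}$ curves. *)

(* Defs.v *)
From HB Require Import structures.
From mathcomp Require Import all_boot all_order all_algebra.
From mathcomp Require Import all_classical all_reals all_analysis.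

Set Implicit Arguments.
Unset Strict Implicit.
Unset Printing Implicit Defensive.

Import Order.TTheory GRing.Theory Num.Theory.
Import numFieldNormedType.Exports.

Local Open Scope classical_set_scope.
Local Open Scope ring_scope.

(* Points of R^n are row vectors; the library's norm on them is the supremum
   norm. *)

Definition dist_int (R : realType) (x : R) : R :=
  inf [set `|x - p%:~R| | p in [set: int]].

Definition int_norm (R : realType) (m : nat) (q : 'rV[int]_m) : R :=
  `| map_mx (fun z : int => z%:~R : R) q |.

Definition linform (R : realType) (n m : nat) (Theta : 'M[R]_(n, m))
    (q : 'rV[int]_m) (i : 'I_n) : R :=
  \sum_(j < m) (q 0 j)%:~R * Theta i j.

(* All the terms of the maxima below are nonnegative, so starting them from 0
   is harmless. *)
Definition Bad (R : realType) (n m : nat) (k : 'I_n -> R) : set 'M[R]_(n, m) :=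
  [set Theta | 0 < inf [set \big[Num.max/0]_(i < n)
      (int_norm R q `^ (m%:R * k i) * dist_int (linform Theta q i))
    | q in [set q : 'rV[int]_m | q != 0]]].

Arguments Bad {R n} m k.

Definition Bad_twisted (R : realType) (n m : nat) (Theta : 'M[R]_(n, m))
    (k : 'I_n -> R) : set 'rV[R]_n :=
  [set x | 0 < inf [set \big[Num.max/0]_(i < n)
      (int_norm R q `^ (m%:R * k i) * dist_int (linform Theta q i - x 0 i))
    | q in [set q : 'rV[int]_m | q != 0]]].

Section Hausdorff.
Context {R : realType} {V : normedModType R}.
Local Open Scope ereal_scope.

Definition diameter (A : set V) : \bar R :=
  ereal_sup [set e | exists x y, [/\ A x, A y & e = `|x - y|%:E]].

(* The empty set contributes nothing, even when s = 0, while a singleton has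
   0 `^ 0 = 1; hence the 0-dimensional measure is the counting measure. *)
Definition hausdorff_gauge (s : R) (A : set V) : \bar R :=
  if A == set0 then 0 else diameter A `^ s.

Definition hausdorff_premeasure (s delta : R) (A : set V) : \bar R :=
  ereal_inf [set \sum_(0 <= i <oo) hausdorff_gauge s (U i)
    | U in [set U : nat -> set V |
        A `<=` \bigcup_i U i /\ forall i, diameter (U i) <= delta%:E]].

Definition hausdorff_measure (s : R) (A : set V) : \bar R :=
  ereal_sup [set hausdorff_premeasure s delta A
    | delta in [set delta : R | (0 < delta)%R]].

Definition hausdorff_dim (A : set V) : \bar R :=
  ereal_inf [set s%:E
    | s in [set s : R | (0 <= s)%R /\ hausdorff_measure s A = 0]].

End Hausdorff.

Section Submanifolds.
Context {R : realType} {n : nat}.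
Implicit Types (M L C U : set 'rV[R]_n) (F : set (set 'rV[R]_n)).

(* [f'] is the derivative of [f] along [a, b], one-sided at the endpoints. *)
Definition C1_path (a b : R) (f f' : R -> 'rV[R]_n) : Prop :=
  (forall x, x \in `[a, b] ->
     (y - x)^-1 *: (f y - f x)
       @[y --> within (`[a, b]%classic `\ x) (nbhs x)] --> f' x) /\
  {within `[a, b], continuous f'}.

Definition nondegenerate_curve C : Prop :=
  exists (a b : R) (f f' : R -> 'rV[R]_n),
    [/\ a < b, C1_path a b f f', C = f @` `[a, b]%classic &
        exists2 x, x \in `[a, b] & forall i, f' x 0 i != 0].

Definition C1_on U (f : 'rV[R]_n -> 'rV[R]_n) : Prop :=
  (forall x, U x -> differentiable f x) /\ {within U, continuous (jacobian f)}.

(* The model of a d-dimensional submanifold: R^d x {0} when J is empty, and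
   the half-space {y_j >= 0} in it when J = {j}. *)
Definition flat (d : nat) (J : {set 'I_n}) : set 'rV[R]_n :=
  [set y | (forall i : 'I_n, (d <= i)%N -> y 0 i = 0) /\
           (forall j, j \in J -> 0 <= y 0 j)].

(* [phi] is a bijection, with inverse [psi], from the open set U onto a cube
   (a ball for the supremum norm) centred at [phi x], and it maps the part of M
   in U onto the part of the model in this cube. *)
Definition flattens M (d : nat) (x : 'rV[R]_n) U (r : R)
    (J : {set 'I_n}) (phi psi : 'rV[R]_n -> 'rV[R]_n) : Prop :=
  [/\ open U /\ U x, 0 < r,
      phi @` U = ball (phi x) r /\ {in U, cancel phi psi},
      (#|J| <= 1)%N & phi @` (M `&` U) = flat d J `&` ball (phi x) r].

(* Embedded submanifolds, possibly with boundary. *)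
Definition C1_submanifold M (d : nat) : Prop :=
  (d <= n)%N /\
  forall x, M x -> exists U r J phi psi,
    [/\ flattens M d x U r J phi psi,
        C1_on U phi & C1_on (ball (phi x) r) psi].

(* A leaf may be a compact curve or, as happens when M has no boundary, fail to
   be compact: it is then exhausted by its compact arcs. *)
Definition nondegenerate_leaf L : Prop :=
  exists C : nat -> set 'rV[R]_n,
    [/\ forall k, nondegenerate_curve (C k),
        forall k, C k `<=` C k.+1 & L = \bigcup_k C k].

(* F is the set of leaves.  In foliated charts, the plaques are the lines on
   which only the coordinate of index 0 varies, and each of them lies in a
   single leaf.  The foliated charts are only required to be homeomorphisms: it
   is the leaves that have to be C^1.  That a leaf meets the domain of a chart
   in countably many plaques needs no separate axiom: a leaf is a countable
   union of rectifiable curves. *)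
Definition foliated_by_nondegenerate_curves M (d : nat) F : Prop :=
  [/\ \bigcup_(L in F) L = M,
      trivIset F id,
      forall L, F L -> nondegenerate_leaf L &
      forall x, M x -> exists U r J phi psi,
        [/\ flattens M d x U r J phi psi,
            {within U, continuous phi},
            {within ball (phi x) r, continuous psi} &
            forall y z,
              (flat d J `&` ball (phi x) r) y ->
              (flat d J `&` ball (phi x) r) z ->
              (forall i : 'I_n, (0 < i)%N -> y 0 i = z 0 i) ->
              forall L, F L -> L (psi y) -> L (psi z)]].

Definition nondegenerate_submanifold M : Prop :=
  exists2 d : nat, (0 < d)%N &
    C1_submanifold M d /\ exists F, foliated_by_nondegenerate_curves M d F.

End Submanifolds.

(* Main.v *)
Require Import Defs.
From HB Require Import structures.
From mathcomp Require Import all_boot all_order all_algebra.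
From mathcomp Require Import all_classical all_reals all_analysis.
From mathcomp Require Import ring lra zify.

Set Implicit Arguments.
Unset Strict Implicit.
Unset Printing Implicit Defensive.

Import Order.TTheory GRing.Theory Num.Theory.
Import numFieldNormedType.Exports.

Local Open Scope classical_set_scope.
Local Open Scope ring_scope.

(** Fix a weight [k] and let [K] be its largest entry.  As [Theta] is badly
    approximable, the boxes with centre [Theta(q) + p] and sides
    [e |q|^(- m k_i)], [|q|] of order [Q], are so far apart that a set of
    diameter [c Q^(- m K)] meets at most one of them, and this box has thickness
    [e Q^(- m K)] in the direction of [K].  Hence, in a chart of the manifold, at
    each step of a Cantor construction the cells to be avoided meet a single thin
    slab [|g_i - c0| <= sigma], and this slab is transverse to some axis of the
    chart because the manifold has a tangent vector all of whose coordinates are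
    nonzero: this is the only use of the foliation.  At least half of the cells
    survive.  Given a cover of the surviving set with small s-dimensional sum,
    s < d, one can moreover choose the cells so that they escape the cover, as the
    part of the sum carried by the sets meeting a cell decreases geometrically for
    the lightest cell.  The dimension of the intersection is thus at least d, and
    that of the manifold is at most d by Lipschitz charts.  The steps are
    shared among countably many weights. *)

(** * Cantor constructions avoiding a cover *)

(** Shifting the coordinate [j] by [b] modulo [2b] is an involution [T], and the hypothesis forbids
    [k] and [T k] to be both bad, so [T] injects the bad cells into the good ones. *)
Lemma card_half_good (d b : nat) (bad : pred {ffun 'I_d -> 'I_(b + b)})
    (j : 'I_d) :
  (0 < b)%N ->
  (forall k k', bad k -> bad k' -> (forall i, i != j -> k i = k' i) ->
     (k' j : nat) <> (k j + b)%N) ->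
  (#|{ffun 'I_d -> 'I_(b + b)}| <= 2 * #|predC bad|)%N.
Proof.
move=> b_gt0 hbad; have b0 : (0 < b + b)%N by rewrite addn_gt0 b_gt0.
pose T (k : {ffun 'I_d -> 'I_(b + b)}) : {ffun 'I_d -> 'I_(b + b)} :=
  [ffun i => if i == j then Ordinal (ltn_pmod (k i + b) b0) else k i].
have Tj k : (T k j : nat) = if (k j < b)%N then (k j + b)%N else (k j - b)%N.
  rewrite ffunE eqxx /=; have h' := ltn_ord (k j); case: (ltnP (k j) b) => h.
    by rewrite modn_small // ltn_add2r.
  rewrite -[in LHS](subnK h) -addnA modnDr modn_small //; lia.
have Ti k i : i != j -> T k i = k i by rewrite ffunE => /negbTE ->.
have TK : involutive T.
  move=> k; apply/ffunP => i; have [->|ij] := eqVneq i j; last by rewrite !Ti.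
  apply: val_inj => /=; rewrite !Tj.
  have h := ltn_ord (k j); case: (ltnP (k j) b) => h1; case: ifP => h2; lia.
have sub : (#|bad| <= #|predC bad|)%N.
  rewrite -(card_imset bad (inv_inj TK)); apply: subset_leq_card; apply/fintype.subsetP => k.
  move=> /imsetP[k' bk' ->]; apply/negP => /= bTk'.
  have := Tj k'; case: ltnP => h e.
    by apply: (hbad k' (T k')) => // i ij; rewrite Ti.
  apply: (hbad (T k') k') => //; first by move=> i ij; rewrite Ti.
  by rewrite e subnK.
by rewrite -(cardC bad) mul2n -addnn leq_add2r.
Qed.

(** The parities of its coordinates determine a cell of [P], since two such cells differ by at most
    one in each coordinate. *)
Lemma card_adjacent_cells (d r : nat) (P : pred {ffun 'I_d -> 'I_r}) :
  (forall k k', P k -> P k' -> forall j, (k j <= (k' j).+1)%N) ->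
  (#|P| <= 2 ^ d)%N.
Proof.
move=> hP; pose F (k : {ffun 'I_d -> 'I_r}) := [ffun j => odd (k j)].
have injF : {in P &, injective F}.
  move=> k k' Pk Pk' /ffunP e; apply/ffunP => j; apply: val_inj => /=.
  have := e j; rewrite !ffunE; have := hP _ _ Pk Pk' j; have := hP _ _ Pk' Pk j.
  lia.
rewrite -(card_in_image injF) (leq_trans (max_card _)) //.
by rewrite card_ffun card_bool card_ord.
Qed.

(** An averaging argument: each weight is counted for at most [K] cells, so the loads of the good
    cells add up to at most [C K], while at least half of the cells are good. *)
Lemma exists_light_cell (R : realType) (T : finType) (w : nat -> R)
    (hit : nat -> T -> bool) (hitp : nat -> bool) (good : pred T) (K : nat) (C : R) :
  (forall i, 0 <= w i) -> (forall i t, hit i t -> hitp i) ->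
  (forall i, hitp i -> (#|hit i| <= K)%N) ->
  (0 < #|T|)%N -> (#|T| <= 2 * #|good|)%N ->
  (\sum_(0 <= i <oo) (if hitp i then (w i)%:E else 0) <= C%:E)%E ->
  exists2 t, good t &
    (\sum_(0 <= i <oo) (if hit i t then (w i)%:E else 0) <=
      (C * (2 * K)%:R / #|T|%:R)%:E)%E.
Proof.
move=> w0 hhp hK T0 Tg hC; apply: contrapT => hno.
have g0 : (0 < #|good|)%N by lia.
have lt1 t : good t -> ((C * (2 * K)%:R / #|T|%:R)%:E <
    \sum_(0 <= i <oo) (if hit i t then (w i)%:E else 0))%E.
  by move=> gt; rewrite ltNge; apply/negP => h; apply: hno; exists t.
have [t0 gt0] : exists t, good t by move/card_gt0P : g0 => [t]; exists t.
have up : (\sum_(t | good t) \sum_(0 <= i <oo) (if hit i t then (w i)%:E else 0)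
    <= (C * K%:R)%:E)%E.
  rewrite -nneseries_sum; last by move=> i t _; case: ifP; rewrite ?lee_fin.
  apply: (@le_trans _ _ (\sum_(0 <= i <oo) K%:R%:E * (if hitp i then (w i)%:E else 0))%E).
    apply: lee_nneseries => [i _ _|i _].
      by apply: sume_ge0 => t _; case: ifP; rewrite ?lee_fin.
    rewrite -big_mkcondr /= sumEFin sumr_const -[X in (X%:E <= _)%E]mulr_natl.
    case: ifP => hp; last first.
      rewrite mule0 lee_fin (_ : #|_| = 0%N) ?mul0r //.
      by apply: eq_card0 => t; rewrite !inE; apply/negbTE/negP => /andP[_ /hhp]; rewrite hp.
    rewrite -EFinM lee_fin ler_wpM2r // ler_nat (leq_trans _ (hK _ hp)) //.
    by apply: subset_leq_card; apply/fintype.subsetP => t /andP[].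
  rewrite nneseriesZl; last by move=> i _; case: ifP; rewrite ?lee_fin.
  by rewrite mulrC EFinM lee_wpmul2l // lee_fin.
have lo : (#|good|%:R%:E * (C * (2 * K)%:R / #|T|%:R)%:E <
    \sum_(t | good t) \sum_(0 <= i <oo) (if hit i t then (w i)%:E else 0))%E.
  rewrite (_ : (_ * _)%E = (\sum_(t | good t) (C * (2 * K)%:R / #|T|%:R)%:E)%E); last first.
    by rewrite sumEFin sumr_const -EFinM mulr_natl.
  rewrite (bigD1 t0) //= [ltRHS](bigD1 t0) //=; apply: lte_leD; last 2 first.
  - exact: lt1.
  - by apply: lee_sum => t /andP[gt _]; exact/ltW/lt1.
  by rewrite sumEFin.
have := lt_le_trans lo up; rewrite -EFinM lte_fin.
have C0 : 0 <= C.
  rewrite -lee_fin (le_trans _ hC) //; apply: nneseries_ge0 => i _ _.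
  by case: ifP; rewrite ?lee_fin.
apply/negP; rewrite -leNgt natrM.
have T0' : 0 < #|T|%:R :> R by rewrite ltr0n.
have : #|T|%:R <= 2 * #|good|%:R :> R by rewrite -natrM ler_nat.
move=> h; rewrite mulrCA [leRHS]mulrA ler_pdivlMr //.
have CK : 0 <= C * K%:R by rewrite mulr_ge0.
nra.
Qed.

Definition cube (R : realType) (d : nat) (u : 'I_d -> R) (s : R) :
    set ('I_d -> R) :=
  [set y | forall j, u j <= y j <= u j + s].

Definition subcube (R : realType) (d r : nat) (u : 'I_d -> R) (s : R)
    (k : {ffun 'I_d -> 'I_r}) : set ('I_d -> R) :=
  cube (fun j => u j + (k j)%:R * s) s.
(** The common point is, coordinate by coordinate, the supremum of the lower corners. *)
Lemma nested_cubes (R : realType) (d : nat) (v : nat -> 'I_d -> R) (s : nat -> R) :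
  (forall N, 0 <= s N) ->
  (forall N, cube (v N.+1) (s N.+1) `<=` cube (v N) (s N)) ->
  exists y, forall N, cube (v N) (s N) y.
Proof.
move=> s0 sub.
have subn N M : (N <= M)%N -> cube (v M) (s M) `<=` cube (v N) (s N).
  move=> /subnK <-; elim: (M - N)%N => [//|p IH] /=.
  by apply: subset_trans IH; rewrite addSn; exact: sub.
have lo N : cube (v N) (s N) (v N) by move=> j; rewrite lexx lerDl s0.
have hi N M j : v N j <= v M j + s M.
  case: (leqP N M) => NM.
    by have /andP[h _] := subn _ _ NM _ (lo M) j; apply: le_trans h _; rewrite lerDl.
  by have /andP[] := subn _ _ (ltnW NM) _ (lo N) j.
exists (fun j => sup [set v N j | N in [set: nat]]) => N j; apply/andP; split.
  apply: ub_le_sup; last by exists N.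
  by exists (v N j + s N) => _ [M _ <-].
by apply: ge_sup; [exists (v 0%N j), 0%N | move=> _ [M _ <-]].
Qed.

Lemma subcube_sub (R : realType) (d r : nat) (u : 'I_d -> R) (s : R)
    (k : {ffun 'I_d -> 'I_r}) :
  0 <= s -> subcube u s k `<=` cube u (r%:R * s).
Proof.
move=> s0 y hy j; have /andP[h1 h2] := hy j; apply/andP; split.
  by apply: le_trans h1; rewrite lerDl mulr_ge0.
apply: le_trans h2 _; rewrite -addrA lerD2l -[X in _ + X]mul1r -mulrDl.
by rewrite ler_wpM2r // natr1 ler_nat ltn_ord.
Qed.

(** The invariant [P] says that the total weight of the [V i] meeting the current cube of step [N]
    is at most [C theta ^ N]. Each such [V i] is then smaller than the next side, hence meets at
    most [2 ^ d] cells, and a light good cell restores the invariant because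
    [2 * 2 ^ d <= theta r ^ d]. *)
Lemma cantor_escape (R : realType) (d b : nat) (u0 : 'I_d -> R) (a C theta : R)
    (V : nat -> set ('I_d -> R)) (w : nat -> R)
    (Good : nat -> ('I_d -> R) -> Prop) :
  (0 < b)%N -> 0 < a -> 0 < C -> 0 < theta < 1 ->
  (2 * 2 ^ d)%:R <= theta * (b + b)%:R ^+ d ->
  (forall i, 0 < w i) -> (\sum_(0 <= i <oo) (w i)%:E <= C%:E)%E ->
  (forall i N, w i <= C * theta ^+ N -> forall y y', V i y -> V i y' ->
     forall j, `|y j - y' j| < a / (b + b)%:R ^+ N.+1) ->
  (forall N u, cube u (a / (b + b)%:R ^+ N) `<=` cube u0 a ->
     exists bad : pred {ffun 'I_d -> 'I_(b + b)},
       (#|{ffun 'I_d -> 'I_(b + b)}| <= 2 * #|predC bad|)%N /\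
       forall k y, ~~ bad k -> subcube u (a / (b + b)%:R ^+ N.+1) k y -> Good N y) ->
  exists y, [/\ cube u0 a y, forall N, Good N y & forall i, ~ V i y].
Proof.
move=> b0 a0 C0 /andP[t0 t1] tr w0 wC Vsmall strat.
set r := (b + b)%N in tr Vsmall strat *.
have r0 : (0 < r)%N by rewrite addn_gt0 b0.
pose side N : R := a / r%:R ^+ N.
have side0 N : 0 < side N by rewrite divr_gt0 // exprn_gt0 // ltr0n.
have sideS N : side N = r%:R * side N.+1.
  by rewrite /side exprS; field; rewrite expf_neq0 pnatr_eq0 -lt0n r0.
pose meets i u s := `[< V i `&` @cube R d u s !=set0 >].
pose load u N := (\sum_(0 <= i <oo) (if meets i u (side N) then (w i)%:E else 0))%E.
pose P N u := cube u (side N) `<=` cube u0 a /\ (load u N <= (C * theta ^+ N)%:E)%E.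
pose next (u : 'I_d -> R) N (k : {ffun 'I_d -> 'I_r}) := fun j => u j + (k j)%:R * side N.+1.
have term0 i u s : (0 <= (if meets i u s then (w i)%:E else 0))%E.
  by case: ifP => _ //; rewrite lee_fin ltW.
(* A single weight is bounded by the load, as all terms are nonnegative; this makes [Vsmall]
   applicable. *)
have meetsw i N u : P N u -> meets i u (side N) -> w i <= C * theta ^+ N.
  move=> [_ hl] hm; rewrite -lee_fin; apply: le_trans hl.
  rewrite -[leLHS]add0e; apply: (@le_trans _ _ (\sum_(0 <= i0 < i.+1)
    (if meets i0 u (side N) then (w i0)%:E else 0))%E); last exact: nneseries_lim_ge.
  by rewrite big_nat_recr //= hm; apply: leeD => //; exact: sume_ge0.
have step N u : P N u -> exists k, P N.+1 (next u N k) /\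
    forall y, cube (next u N k) (side N.+1) y -> Good N y.
  move=> Pu; have [hsub hl] := Pu.
  have [bad [cbad hbad]] := strat _ _ hsub.
  have sub k : cube (next u N k) (side N.+1) `<=` cube u (side N).
    by rewrite (sideS N); apply: (subcube_sub (k := k)); exact/ltW.
  have T0 : (0 < #|{ffun 'I_d -> 'I_r}|)%N.
    by rewrite card_ffun !card_ord expn_gt0 r0.
  have h1 i k : meets i (next u N k) (side N.+1) -> meets i u (side N).
    by move=> /asboolP[y [Vy cy]]; apply/asboolP; exists y; split=> //; apply: sub cy.
  have h2 i : meets i u (side N) ->
      (#|(fun k => meets i (next u N k) (side N.+1))| <= 2 ^ d)%N.
    move=> hm; apply: card_adjacent_cells => k k' /asboolP[y [Vy cy]] /asboolP[y' [Vy' cy']] j.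
    have := Vsmall _ _ (meetsw _ _ _ Pu hm) _ _ Vy Vy' j.
    rewrite -/(side N.+1) ltr_norml => /andP[_ hlt].
    have /andP[c1 c2] := cy j; have /andP[c3 c4] := cy' j.
    rewrite /next in c1 c2 c3 c4.
    (* The lower face of the cell [k] lies below [y j], the upper face of [k'] above [y' j], and
       [y j - y' j < side N.+1]; the strict inequality gives [k j <= k' j + 1]. *)
    have : (k j)%:R * side N.+1 < (k' j + 2)%:R * side N.+1.
      rewrite natrD; lra.
    by rewrite ltr_pM2r // ltr_nat addn2 ltnS.
  have [k gk hk] := exists_light_cell (fun i => ltW (w0 i)) h1 h2 T0 cbad hl.
  exists k; split; last by move=> y; apply: hbad.
  split; first exact: subset_trans (sub k) hsub.
  apply: le_trans hk _; rewrite lee_fin card_ffun !card_ord exprSr mulrA.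
  rewrite ler_pdivrMr; last by rewrite ltr0n expn_gt0 r0.
  rewrite -[leRHS]mulrA ler_pM2l ?mulr_gt0 ?exprn_gt0 //.
  by rewrite natrX.
have P0 : P 0%N u0.
  split; first by rewrite /side expr0 divr1.
  rewrite expr0 mulr1; apply: le_trans wC; apply: lee_nneseries => i _ //.
  by case: ifP => _ //; rewrite lee_fin ltW.
have /choice[f hf] : forall Nu : nat * ('I_d -> R), exists k, P Nu.1 Nu.2 ->
    P Nu.1.+1 (next Nu.2 Nu.1 k) /\
    forall y, cube (next Nu.2 Nu.1 k) (side Nu.1.+1) y -> Good Nu.1 y.
  move=> [N u]; have [/step[k hk]|nP] := pselect (P N u); first by exists k.
  by exists [ffun=> Ordinal r0].
pose v := fix v N := if N is N'.+1 then next (v N') N' (f (N', v N')) else u0.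
have Pv N : P N (v N).
  by elim: N => [//|N IH] /=; have [] := hf (N, v N) IH.
have [y hy] : exists y, forall N, cube (v N) (side N) y.
  apply: nested_cubes => [N|N]; first exact/ltW.
  by rewrite (sideS N); apply: (subcube_sub (k := f (N, v N))); exact/ltW.
exists y; split.
- by have := hy 0%N; rewrite /side expr0 divr1.
- by move=> N; have [_ h] := hf (N, v N) (Pv N); apply/h/(hy N.+1).
(* A set [V i] containing the limit point meets every cube, so its positive weight is at most
   [C theta ^ N] for all [N], which tends to 0. *)
- move=> i Vy.
  have hw N : w i <= C * theta ^+ N.
    by apply: (meetsw _ _ _ (Pv N)); apply/asboolP; exists y.
  have : theta ^+ N @[N --> \oo] --> 0 by apply: cvg_expr; rewrite gtr0_norm.
  move=> /cvgrPdist_lt /(_ (w i / C)); rewrite divr_gt0 // => /(_ isT)[N _ /(_ N)] /=.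
  rewrite leqnn => /(_ isT); rewrite sub0r normrN gtr0_norm ?exprn_gt0 //.
  by rewrite ltr_pdivlMr // mulrC ltNge hw.
Qed.
(** * Separation of the resonances *)

Lemma entry_le_norm (R : realType) (p q : nat) (A : 'M[R]_(p, q)) i j :
  `|A i j| <= `|A|.
Proof.
rewrite /Num.norm /= mx_normrE.
exact: (le_bigmax 0 (fun ij : 'I_p * 'I_q => `|A ij.1 ij.2|) (i, j)).
Qed.

Lemma norm_le_entries (R : realType) (p q : nat) (A : 'M[R]_(p, q)) (e : R) :
  0 <= e -> (forall i j, `|A i j| <= e) -> `|A| <= e.
Proof.
move=> e0 h; rewrite /Num.norm /= mx_normrE.
by apply/bigmax_leP; split=> [|[i j] _] //=.
Qed.

(** The set [P] has to be inhabited because the infimum of the empty set is 0 by convention. *)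
Lemma inf_bigmax_gt0 (R : realType) (T : Type) (P : set T) (n : nat)
    (F : T -> 'I_n -> R) :
  P !=set0 -> (forall q i, 0 <= F q i) ->
  0 < inf [set \big[Num.max/0]_(i < n) F q i | q in P] <->
  exists2 e : R, 0 < e & forall q, P q -> exists i, e <= F q i.
Proof.
move=> P0 F0; split => [e0|[e e0 he]].
  exists (inf [set \big[Num.max/0]_(i < n) F q i | q in P]) => // q Pq.
  apply: contrapT => /forallNP h.
  have : inf [set \big[Num.max/0]_(i < n) F q i | q in P] <= \big[Num.max/0]_(i < n) F q i.
    by apply: ge_inf; [exists 0 => _ [q' _ <-]; exact: bigmax_ge_id|exists q].
  apply/negP; rewrite -ltNge; apply/bigmax_ltP; split=> // i _.
  by rewrite ltNge; apply/negP/h.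
apply: lt_le_trans e0 _; apply: lb_le_inf.
  by case: P0 => q Pq; exists (\big[Num.max/0]_(i < n) F q i), q.
move=> _ [q Pq <-]; have [i hi] := he q Pq.
by apply: le_trans hi _; exact: le_bigmax.
Qed.

Section dist_int.
Context {R : realType}.

Lemma dist_int_le (x : R) (p : int) : dist_int x <= `|x - p%:~R|.
Proof. by apply: ge_inf; [exists 0 => _ [? _ <-]|exists p]. Qed.

Lemma dist_int_ge0 (x : R) : 0 <= dist_int x.
Proof. by apply: lb_le_inf => [|_ [p _ <-]] //; exists `|x - 0%:~R|, 0. Qed.

Lemma dist_int_lt (x e : R) : dist_int x < e -> exists p : int, `|x - p%:~R| < e.
Proof.
by move=> /inf_lt[|_ [p _ <-] h]; [exists `|x - 0%:~R|, 0|exists p].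
Qed.

End dist_int.

Section int_norm.
Context {R : realType} {m : nat}.
Implicit Types q : 'rV[int]_m.

Lemma int_norm_ge1 q : q != 0 -> 1 <= int_norm R q.
Proof.
move=> q0; have [j qj] : exists j, q 0 j != 0.
  apply: contrapT => /forallNP h; move/eqP: q0; apply; apply/rowP => j.
  by rewrite mxE; apply/eqP/negPn/negP/h.
apply: le_trans (entry_le_norm _ 0 j); rewrite mxE -intr_norm ler1z.
by rewrite -gtz0_ge1 normr_gt0.
Qed.

Lemma int_normB q q' : int_norm R (q - q') <= int_norm R q + int_norm R q'.
Proof. by rewrite /int_norm map_mxB ler_normB. Qed.

Lemma linformB (n : nat) (Theta : 'M[R]_(n, m)) q q' i :
  linform Theta (q - q') i = linform Theta q i - linform Theta q' i.
Proof.
rewrite /linform -sumrB; apply: eq_bigr => j _.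
by rewrite !mxE intrD intrN mulrBl.
Qed.

End int_norm.

Section separation.
Context {R : realType} {n m : nat}.
Variables (k : 'I_n -> R) (Theta : 'M[R]_(n, m)).
Hypotheses (hm : (1 <= m)%N) (k_gt0 : forall i, 0 < k i)
  (k_sum : \sum_(i < n) k i = 1).

Let rV_neq0 : [set q : 'rV[int]_m | q != 0] !=set0.
Proof.
case: m hm => // m' _; exists (const_mx 1); apply/eqP => /rowP /(_ ord0).
by rewrite !mxE.
Qed.

Lemma BadP : Bad m k Theta <-> exists2 c : R, 0 < c &
  forall q : 'rV[int]_m, q != 0 ->
    exists i, c <= int_norm R q `^ (m%:R * k i) * dist_int (linform Theta q i).
Proof.
apply: inf_bigmax_gt0 => // q i.
by rewrite mulr_ge0 ?powR_ge0 ?dist_int_ge0.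
Qed.

Lemma Bad_twistedP x : Bad_twisted Theta k x <-> exists2 c : R, 0 < c &
  forall q : 'rV[int]_m, q != 0 ->
    exists i, c <= int_norm R q `^ (m%:R * k i) * dist_int (linform Theta q i - x 0 i).
Proof.
apply: inf_bigmax_gt0 => // q i.
by rewrite mulr_ge0 ?powR_ge0 ?dist_int_ge0.
Qed.

Lemma weight_le1 i : k i <= 1.
Proof.
by rewrite -k_sum (bigD1 i) //= lerDl; apply: sumr_ge0 => j _; exact/ltW.
Qed.

(* The boxes of the resonances in one stage are so far apart that a small set
   meets only one of them; in the direction of the largest weight that box is
   thinner than the set. *)
Lemma one_resonance_per_stage (rho D sigma : R) :
  (0 < n)%N -> Bad m k Theta -> 1 < rho -> 0 < D <= 4^-1 -> 0 < sigma ->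
  exists (e : R) (stage : nat -> set 'rV[int]_m) (i0 : 'I_n),
    [/\ 0 < e, forall q, q != 0 -> exists l, stage l q &
     forall l (X : set 'rV[R]_n),
       (forall x x', X x -> X x' -> forall i, `|x 0 i - x' 0 i| <= D / rho ^+ l) ->
       exists c0 : R, forall x, X x -> sigma / rho ^+ l < `|x 0 i0 - c0| ->
         forall q, stage l q -> exists i,
           e <= int_norm R q `^ (m%:R * k i) * dist_int (linform Theta q i - x 0 i)].
Proof.
move=> n0 /BadP[c c0 hc] rho1 /andP[D0 D4] sigma0.
have rho0 : 0 < rho := lt_trans ltr01 rho1.
have m0 : 0 < m%:R :> R by rewrite ltr0n.
pose i0 := [arg max_(i > Ordinal n0) k i]%O.
have k_le i : k i <= k i0.
  by rewrite /i0; case: arg_maxP => // j _ h; exact: h.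
pose K := m%:R * k i0; have K0 : 0 < K by rewrite mulr_gt0.
have Kle i : m%:R * k i <= K by rewrite ler_pM2l.
(* The ratio of the ranges of [|q|] is chosen so that [|q| ^ K] grows by the factor [rho] from one
   stage to the next. *)
pose C1 := rho `^ K^-1.
have C1K : C1 `^ K = rho.
  by rewrite /C1 -powRrM mulVf ?gt_eqF // powRr1 // ltW.
have C1_gt1 : 1 < C1.
  rewrite ltNge; apply/negP => h; have := rho1; rewrite -C1K ltNge => /negP; apply.
  by have := ge0_ler_powR (ltW K0) (powR_ge0 _ _) ler01 h; rewrite powR1.
have C10 : 0 < C1 := lt_trans ltr01 C1_gt1.
have C1lK l : (C1 ^+ l) `^ K = rho ^+ l.
  by rewrite -powR_mulrn ?ltW // -powRrM mulrC powRrM C1K powR_mulrn // ltW.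
(* With [|q - q'| <= 2 h C1 ^ (l + 1)], this value makes [|q - q'| ^ K * D / rho ^ l] at most
   [c / 4]; the bound [h <= 1] lets the stages reach all [|q| >= 1]. *)
pose h0 := (c / (4 * rho * D)) `^ K^-1 / 2.
pose h := Num.min 1 h0.
have h0_gt0 : 0 < h0 by rewrite divr_gt0 // powR_gt0 // divr_gt0 // !mulr_gt0.
have h_gt0 : 0 < h by rewrite lt_min ltr01.
have h1 : h <= 1 by rewrite ge_min lexx.
have hK : (2 * h) `^ K <= c / (4 * rho * D).
  have -> : c / (4 * rho * D) = (2 * h0) `^ K.
    rewrite /h0 [2 * _]mulrC divfK // -powRrM mulVf ?gt_eqF // powRr1 // ltW //.
    by rewrite divr_gt0 // !mulr_gt0.
  apply: (ge0_ler_powR (ltW K0)).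
  - by rewrite nnegrE ltW // mulr_gt0.
  - by rewrite nnegrE ltW // mulr_gt0.
  by rewrite ler_pM2l // ge_min lexx orbT.
(* The three bounds on [e] serve respectively to identify the integer parts, to make two of the
   error terms at most [c / 4], and to make the box thinner than the slab. *)
pose e := Num.min 8^-1 (Num.min (c / 4 / (1 + C1) ^+ m) (sigma * h `^ K)).
have e0 : 0 < e.
  by rewrite !lt_min invr_gt0 ltr0n /= divr_gt0 ?divr_gt0 ?exprn_gt0 ?addr_gt0 // mulr_gt0 // powR_gt0.
have e8 : e <= 8^-1 by rewrite ge_min lexx.
have ec : e * (1 + C1) ^+ m <= c / 4.
  rewrite -ler_pdivlMr ?exprn_gt0 ?addr_gt0 //.
  by rewrite /e ge_min ge_min lexx orbT.
have es : e <= sigma * h `^ K by rewrite /e ge_min ge_min lexx !orbT.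
pose stage l := [set q : 'rV[int]_m |
  q != 0 /\ h * C1 ^+ l <= int_norm R q < h * C1 ^+ l.+1].
exists e, stage, i0; split=> //.
  move=> q q0; have q1 := int_norm_ge1 (R := R) q0.
  have ex : exists l, int_norm R q < h * C1 ^+ l.
    have : (C1^-1) ^+ l @[l --> \oo] --> 0.
      by apply: cvg_expr; rewrite gtr0_norm ?invr_gt0 // invf_lt1.
    move=> /cvgrPdist_lt /(_ (h / int_norm R q)).
    have qp : 0 < int_norm R q by exact: lt_le_trans ltr01 q1.
    rewrite divr_gt0 // => /(_ isT)[N _ /(_ N)] /=.
    rewrite leqnn => /(_ isT); rewrite sub0r normrN gtr0_norm ?exprn_gt0 ?invr_gt0 //.
    rewrite ltr_pdivlMr // exprVn mulrC ltr_pdivrMr ?exprn_gt0 // => ?.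
    by exists N.
  case: (ex_minnP ex) => -[|l] hl hmin.
    by exfalso; move: hl; rewrite expr0 mulr1 ltNge (le_trans h1 q1).
  exists l; split=> //; rewrite hl andbT leNgt; apply/negP => /hmin.
  by rewrite ltnn.
move=> l X hX.
have rl0 : 0 < rho ^+ l by rewrite exprn_gt0.
pose res (x : 'rV[R]_n) (q : 'rV[int]_m) := forall i, exists p : int,
  `|linform Theta q i - x 0 i - p%:~R| * int_norm R q `^ (m%:R * k i) < e.
have qpos q : stage l q -> 0 < int_norm R q.
  by by move=> [/(int_norm_ge1 (R := R)) q1 _]; exact: lt_le_trans ltr01 q1.
have resP (x : 'rV[R]_n) (q : 'rV[int]_m) : stage l q ->
    ~ (exists i, e <= int_norm R q `^ (m%:R * k i) * dist_int (linform Theta q i - x 0 i)) ->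
    res x q.
  move=> sq /forallNP hno i; have /negP := hno i; rewrite -ltNge => hlt.
  have wp : 0 < int_norm R q `^ (m%:R * k i) by rewrite powR_gt0 // qpos.
  have : dist_int (linform Theta q i - x 0 i) < e / int_norm R q `^ (m%:R * k i).
    by rewrite ltr_pdivlMr // mulrC.
  by move=> /dist_int_lt[p hp]; exists p; rewrite -ltr_pdivlMr.
(* If [X] meets no box of the stage, any slab will do, and 0 is taken as its centre. Otherwise a box
   that meets [X] determines the slab. *)
have [[[x q] [Xx sq rxq]]|noX] := pselect (exists xq : 'rV[R]_n * 'rV[int]_m,
    [/\ X xq.1, stage l xq.2 & res xq.1 xq.2]); last first.
  exists 0 => x Xx _ q sq; apply: contrapT => hno.
  by apply: noX; exists (x, q); split=> //; exact: resP.
have {rxq}/choice[p hp] := rxq; rewrite /= in Xx sq hp.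
exists (linform Theta q i0 - (p i0)%:~R) => x' Xx' far q' sq'.
apply: contrapT => hno.
have /choice[p' hp'] := resP _ _ sq' hno.
have Wge1 (q1 : 'rV[int]_m) i : q1 != 0 -> 1 <= int_norm R q1 `^ (m%:R * k i).
  move=> q10; rewrite -[leLHS](powRr0 (int_norm R q1)) ler_powR ?int_norm_ge1 //.
  by rewrite mulr_ge0 // ltW.
have bnd (q1 : 'rV[int]_m) (x1 : 'rV[R]_n) (p1 : int) i : stage l q1 ->
    `|linform Theta q1 i - x1 0 i - p1%:~R| * int_norm R q1 `^ (m%:R * k i) < e ->
    `|linform Theta q1 i - x1 0 i - p1%:~R| < e.
  move=> s1; apply: le_lt_trans; rewrite ler_peMr // Wge1 //; by case: s1.
have D1 : D / rho ^+ l <= D.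
  by rewrite ler_pdivrMr // ler_pMr // exprn_ege1 // ltW.
(* If [q] and [q'] were distinct, bad approximability at [q - q'] would give some [i] where [W]
   times the distance is at least [c], whereas the two box errors and the displacement from [x] to
   [x'] contribute at most [c / 4] each. *)
have eqq : q = q'.
  apply: contrapT => /eqP; rewrite -subr_eq0 => neq.
  have [i] := hc _ neq; apply/negP; rewrite -ltNge linformB.
  set W := _ `^ _; have W0 : 0 < W by exact: lt_le_trans (Wge1 _ _ neq).
  have dW : dist_int (linform Theta q i - linform Theta q' i) <=
    `|linform Theta q i - x 0 i - (p i)%:~R| + `|x 0 i - x' 0 i| +
      `|linform Theta q' i - x' 0 i - (p' i)%:~R|.
    apply: le_trans (dist_int_le _ (p i - p' i)) _.
    rewrite [X in `|X|](_ : _ = (linform Theta q i - x 0 i - (p i)%:~R) + (x 0 i - x' 0 i) -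
      (linform Theta q' i - x' 0 i - (p' i)%:~R)); last by rewrite intrD intrN; ring.
    by apply: le_trans (ler_normB _ _) _; rewrite lerD2r ler_normD.
  (* Within a stage [|q2| <= C1 |q1|], and [m k_i <= m]; hence
     [W <= (1 + C1) ^ m |q1| ^ (m k_i)]. *)
  have halves (q1 q2 : 'rV[int]_m) (x1 : 'rV[R]_n) (p1 : int) : stage l q1 -> stage l q2 ->
      W <= (int_norm R q1 + int_norm R q2) `^ (m%:R * k i) ->
      `|linform Theta q1 i - x1 0 i - p1%:~R| * int_norm R q1 `^ (m%:R * k i) < e ->
      W * `|linform Theta q1 i - x1 0 i - p1%:~R| <= c / 4.
    move=> s1 s2 hW h1'; have q1p := qpos _ s1; have q2p := qpos _ s2.
    apply: (@le_trans _ _ (e * (1 + C1) ^+ m)) => //.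
    have h2 : int_norm R q1 + int_norm R q2 <= (1 + C1) * int_norm R q1.
      case: s1 s2 => _ /andP[s1 _] [_ /andP[_ s2]].
      rewrite mulrDl mul1r lerD2l; apply: le_trans (ltW s2) _.
      by rewrite exprS mulrCA ler_pM2l.
    have C11 : 0 < 1 + C1 by rewrite addr_gt0.
    have h3 : W <= (1 + C1) ^+ m * int_norm R q1 `^ (m%:R * k i).
      apply: le_trans hW _; apply: (@le_trans _ _ (((1 + C1) * int_norm R q1) `^ (m%:R * k i))).
        apply: ge0_ler_powR h2; first by rewrite mulr_ge0 ?(ltW (k_gt0 i)).
          by rewrite nnegrE addr_ge0 ?(ltW q1p) ?(ltW q2p).
        by rewrite nnegrE mulr_ge0 ?(ltW C11) ?(ltW q1p).
      rewrite powRM ?(ltW q1p) ?(ltW C11) // ler_pM2r ?powR_gt0 //.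
      rewrite -powR_mulrn ?(ltW C11) // ler_powR ?lerDl ?(ltW C10) //.
      by rewrite -[leRHS]mulr1 ler_pM2l // weight_le1.
    apply: le_trans (ler_wpM2r _ h3) _ => //.
    rewrite -mulrA mulrC ler_pM2r ?exprn_gt0 ?addr_gt0 // mulrC.
    exact/ltW.
  have hWq : W <= (int_norm R q + int_norm R q') `^ (m%:R * k i).
    apply: ge0_ler_powR (int_normB _ _); rewrite ?nnegrE ?normr_ge0 //.
      by rewrite mulr_ge0 ?(ltW (k_gt0 i)).
    by rewrite addr_ge0 ?(ltW (qpos _ sq)) ?(ltW (qpos _ sq')).
  have e1 := halves _ _ _ _ sq sq' hWq (hp i).
  have hWq' : W <= (int_norm R q' + int_norm R q) `^ (m%:R * k i) by rewrite addrC.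
  have e2 := halves _ _ _ _ sq' sq hWq' (hp' i).
  (* Here the exponent [m k_i] may be raised to [K], as [|q - q'| >= 1]. *)
  have e3 : W * `|x 0 i - x' 0 i| <= c / 4.
    have hW : W <= (2 * h) `^ K * rho ^+ l.+1.
      apply: (@le_trans _ _ (int_norm R (q - q') `^ K)).
        by rewrite ler_powR // int_norm_ge1.
      have hC : 0 < h * C1 ^+ l.+1 by rewrite mulr_gt0 // exprn_gt0.
      rewrite -C1lK -powRM ?(ltW (exprn_gt0 _ _)) ?mulr_ge0 ?(ltW h_gt0) //.
      apply: (ge0_ler_powR (ltW K0)); rewrite ?nnegrE ?normr_ge0 //.
        by rewrite -mulrA mulr_ge0 // ltW.
      apply: le_trans (int_normB _ _) _.
      case: sq sq' => _ /andP[_ s1] [_ /andP[_ s2]]; rewrite -mulrA mulr_natl mulr2n.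
      by apply: lerD; exact: ltW.
    apply: (@le_trans _ _ ((c / (4 * rho * D) * rho ^+ l.+1) * (D / rho ^+ l))).
      apply: ler_pM => //; first exact: ltW.
        by apply: le_trans hW _; rewrite ler_pM2r // exprn_gt0.
      exact: hX.
    rewrite exprS le_eqVlt; apply/orP; left; apply/eqP; field.
    by rewrite !gt_eqF // exprn_gt0.
  have : W * dist_int (linform Theta q i - linform Theta q' i) <= c / 4 + c / 4 + c / 4.
    by apply: le_trans (ler_wpM2l (ltW W0) dW) _; rewrite !mulrDr !lerD.
  by move=> h2; apply: le_lt_trans h2 _; lra.
subst q'.
(* The two integers differ by less than [2 e + D <= 1 / 2]. *)
have eqp : p i0 = p' i0.
  apply/eqP; rewrite -subr_eq0 -normr_eq0; apply/eqP.
  have : (`|p i0 - p' i0|%:~R : R) < 1.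
    rewrite intr_norm intrD intrN.
    have b1 := bnd _ _ _ _ sq (hp i0); have b2 := bnd _ _ _ _ sq (hp' i0).
    have b3 := le_trans (hX _ _ Xx Xx' i0) D1.
    move: b1 b2 b3; rewrite !ltr_norml !ler_norml => /andP[??] /andP[??] /andP[??].
    by apply/andP; split; lra.
  by rewrite ltrz1; case: (p i0 - p' i0) => -[].
(* With the same [q] and the same integer, [x'] would lie within [e / |q| ^ K <= sigma / rho ^ l] of
   the centre of the slab, against [far]; this uses the lower bound [|q| >= h C1 ^ l] of the
   stage. *)
have := hp' i0; apply/negP; rewrite -leNgt -eqp.
have -> : linform Theta q i0 - x' 0 i0 - (p i0)%:~R =
  - (x' 0 i0 - (linform Theta q i0 - (p i0)%:~R)) by ring.
rewrite normrN; apply: le_trans es _.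
apply: (@le_trans _ _ (sigma / rho ^+ l * int_norm R q `^ (m%:R * k i0))); last first.
  by rewrite ler_pM2r ?powR_gt0 ?qpos // ltW.
rewrite -[leRHS]mulrA ler_pM2l // mulrC ler_pdivlMr // -C1lK.
rewrite -powRM ?(ltW (exprn_gt0 _ _)) ?(ltW h_gt0) //.
apply: (ge0_ler_powR (ltW K0)); rewrite ?nnegrE ?normr_ge0 //; last by case: sq => _ /andP[].
by rewrite mulr_ge0 ?(ltW (exprn_gt0 _ _)) ?(ltW h_gt0).
Qed.

End separation.

(** * Sharing the steps among countably many weights *)

Lemma odd_part_unique t l t' l' :
  (2 ^ t * l.*2.+1 = 2 ^ t' * l'.*2.+1)%N -> t = t' /\ l = l'.
Proof.
have log t1 l1 : logn 2 (2 ^ t1 * l1.*2.+1) = t1.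
  rewrite lognM ?expn_gt0 // pfactorK // lognE /= dvdn2 /= odd_double /=.
  by rewrite addn0.
move=> e; have et : t = t' by rewrite -(log t l) e log.
split=> //; move: e; rewrite et => /eqP; rewrite eqn_pmul2l ?expn_gt0 //.
by rewrite eqSS => /eqP /double_inj.
Qed.

(** The exponent is the 2-adic valuation; together with uniqueness, the step [N] is assigned to
    exactly one weight [t] and one stage [l]. *)
Lemma odd_part_exists N : exists t l, N.+1 = (2 ^ t * l.*2.+1)%N.
Proof.
have [p cp e] := @pfactor_coprime 2 N.+1 isT isT.
rewrite coprime2n in cp; exists (logn 2 N.+1), p./2.
by rewrite [LHS]e mulnC -[in LHS](odd_double_half p) cp.
Qed.

Section twisted_game.
Context {R : realType} {n m d : nat}.
Variables (k : nat -> 'I_n -> R) (Theta : 'M[R]_(n, m)).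
Hypotheses (hn : (1 <= n)%N) (hm : (1 <= m)%N)
  (k_gt0 : forall t i, 0 < k t i) (k_sum : forall t, \sum_(i < n) k t i = 1)
  (hTheta : (\bigcap_t Bad m (k t)) Theta).
Variables (g : ('I_d -> R) -> 'rV[R]_n) (u0 : 'I_d -> R) (a L : R).
Hypotheses (a_gt0 : 0 < a) (L_gt0 : 0 < L) (La : L * a <= 4^-1).
Hypothesis g_lip : forall y y', cube u0 a y -> cube u0 a y' ->
  forall tau, 0 <= tau -> (forall j, `|y j - y' j| <= tau) ->
  forall i, `|g y 0 i - g y' 0 i| <= L * tau.

(* The tuple of index t is dealt with at the steps N such that N + 1 is an odd
   multiple of 2 ^ t, so that its steps form an arithmetic progression. *)
Lemma twisted_strategy (r : nat) : (1 < r)%N ->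
  exists Good : nat -> ('I_d -> R) -> Prop,
    (forall N u, cube u (a / r%:R ^+ N) `<=` cube u0 a ->
       exists (i : 'I_n) c0, forall y, cube u (a / r%:R ^+ N) y ->
         a / r%:R ^+ N.+1 < `|g y 0 i - c0| -> Good N y) /\
    (forall y, (forall N, Good N y) ->
       (\bigcap_t Bad_twisted Theta (k t)) (g y)).
Proof.
move=> r1; have r0 : 0 < r%:R :> R by rewrite ltr0n ltnW.
have r1' : 1 < r%:R :> R by rewrite ltr1n.
have re j : 0 < r%:R ^+ j :> R by rewrite exprn_gt0.
(* For [N + 1 = 2 ^ t (2 l + 1)] one has [N = 2 ^ t - 1 + 2 ^ (t + 1) l]. Hence the values of [rho],
   [D] and [sigma] chosen here turn the diameter [D / rho ^ l] into [L a / r ^ N] and the half-width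
   [sigma / rho ^ l] of the slab into [a / r ^ (N + 1)]. *)
have /choice[e /choice[stage /choice[i0 H]]] : forall t, exists (e : R)
    (stage : nat -> set 'rV[int]_m) (i0 : 'I_n),
  [/\ 0 < e, forall q, q != 0 -> exists l, stage l q &
     forall l (X : set 'rV[R]_n),
       (forall x x', X x -> X x' -> forall i,
         `|x 0 i - x' 0 i| <= L * a / r%:R ^+ (2 ^ t).-1 / (r%:R ^+ (2 ^ t.+1)) ^+ l) ->
       exists c0 : R, forall x, X x ->
         a / r%:R ^+ (2 ^ t) / (r%:R ^+ (2 ^ t.+1)) ^+ l < `|x 0 i0 - c0| ->
         forall q, stage l q -> exists i, e <= int_norm R q `^ (m%:R * k t i) *
           dist_int (linform Theta q i - x 0 i)].
  move=> t; apply: one_resonance_per_stage => //.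
  - exact: hTheta.
  - by rewrite exprn_egt1 // -lt0n expn_gt0.
  - rewrite divr_gt0 ?mulr_gt0 //=; apply: le_trans La.
    by rewrite ler_pdivrMr // ler_peMr ?exprn_ege1 ?(ltW r1') // ltW // mulr_gt0.
  - by rewrite divr_gt0.
(* Quantifying over [t] and [l] avoids choosing the decomposition of [N + 1], which is unique
   anyway. *)
pose Good N y := forall t l, N.+1 = (2 ^ t * l.*2.+1)%N -> forall q, stage t l q ->
  exists i, e t <= int_norm R q `^ (m%:R * k t i) *
           dist_int (linform Theta q i - g y 0 i).
exists Good; split=> [N u sub|y hG t _].
  have [t [l eN]] := odd_part_exists N; have [_ _ /(_ l)] := H t.
  move=> /(_ (g @` cube u (a / r%:R ^+ N)))[].
    move=> _ _ [y cy <-] [y' cy' <-] i.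
    rewrite (_ : L * a / _ / _ = L * (a / r%:R ^+ N)); last first.
      rewrite -!mulrA -exprM -invfM -exprD; congr (_ * (_ * (_ ^+ _)^-1)).
      have := expn_gt0 2 t; rewrite -mul2n in eN; rewrite expnS; nia.
    apply: g_lip; [exact: sub|exact: sub|by rewrite divr_ge0 ?ltW|] => j.
    have /andP[? ?] := cy j; have /andP[? ?] := cy' j.
    by rewrite ler_norml; apply/andP; split; lra.
  move=> c0 hc0; exists (i0 t), c0 => y cy far t' l'; rewrite eN => /odd_part_unique[<- <-].
  apply: (hc0 (g y)); first by exists y.
  apply: le_lt_trans far; rewrite eN -!mulrA -exprM -invfM -exprD.
  rewrite le_eqVlt; apply/orP; left; apply/eqP; congr (_ * (_ ^+ _)^-1).
  rewrite expnS -mul2n; nia.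
apply/Bad_twistedP => //; have [e0 hq _] := H t; exists (e t) => // q /hq[l sl].
by apply: (hG (2 ^ t * l.*2.+1).-1 t l) => //; rewrite prednK // muln_gt0 expn_gt0.
Qed.

Hypothesis d_gt0 : (0 < d)%N.
Variables (delta Lam : R).
Hypotheses (delta_gt0 : 0 < delta) (Lam_gt0 : 0 < Lam).
Hypothesis g_transverse : forall i : 'I_n, exists j : 'I_d,
  forall y y', cube u0 a y -> cube u0 a y' ->
  forall tau, 0 <= tau -> (forall j', j' != j -> `|y j' - y' j'| <= tau) ->
  delta * `|y j - y' j| <= `|g y 0 i - g y' 0 i| + L * tau.
Hypothesis g_expand : forall y y', cube u0 a y -> cube u0 a y' ->
  forall j, `|y j - y' j| <= Lam * `|g y - g y'|.

(** Take two cells that meet the slab, agree off [j] and are [b] apart along [j]. Their points in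
    the slab are at least [(b - 1) s] apart along [j], whereas transversality allows at most
    [(2 + L) s / delta]: the slab accounts for [2 s] and the other coordinates for [L s]. *)
Lemma card_slab (b N : nat) (u : 'I_d -> R) (i : 'I_n) (c0 : R) :
  (0 < b)%N -> 2 + L < delta * (b%:R - 1) ->
  cube u (a / (b + b)%:R ^+ N) `<=` cube u0 a ->
  (#|{ffun 'I_d -> 'I_(b + b)}| <= 2 * #|predC
    (fun k : {ffun 'I_d -> 'I_(b + b)} =>
       `[< exists2 y, subcube u (a / (b + b)%:R ^+ N.+1) k y &
             `|g y 0 i - c0| <= a / (b + b)%:R ^+ N.+1 >]%R)|)%N.
Proof.
move=> b0 hb sub; have [j hj] := g_transverse i.
set s := a / (b + b)%:R ^+ N.+1.
have r0 : 0 < (b + b)%:R :> R by rewrite ltr0n addn_gt0 b0.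
have s0 : 0 < s by rewrite divr_gt0 // exprn_gt0.
have subk (k' : {ffun 'I_d -> 'I_(b + b)}) : subcube u s k' `<=` cube u0 a.
  apply: subset_trans sub; rewrite (_ : a / _ = (b + b)%:R * s).
    by apply: subcube_sub; exact: ltW.
  by rewrite /s exprS invfM mulrCA mulVKf ?gt_eqF.
apply: (@card_half_good _ _ _ j) => // k1 k2 /asboolP[y1 c1 h1] /asboolP[y2 c2 h2] eqk ej.
have h : delta * `|y1 j - y2 j| <= `|g y1 0 i - g y2 0 i| + L * s.
  apply: hj; [exact: subk c1|exact: subk c2|exact: ltW|] => j' jj'.
  have /andP[? ?] := c1 j'; have /andP[] := c2 j'; rewrite -eqk // => ? ?.
  by rewrite ler_norml; apply/andP; split; lra.
have h3 : `|g y1 0 i - g y2 0 i| <= 2 * s.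
  move: h1 h2; rewrite !ler_norml => /andP[? ?] /andP[? ?].
  by apply/andP; split; lra.
have h4 : (b%:R - 1) * s <= `|y1 j - y2 j|.
  have /andP[? h5] := c1 j; have /andP[h6 ?] := c2 j.
  rewrite ej natrD in h6; rewrite distrC ler_normr; apply/orP; left; lra.
have : delta * ((b%:R - 1) * s) <= (2 + L) * s.
  apply: le_trans (ler_wpM2l (ltW delta_gt0) h4) _; lra.
by rewrite mulrA ler_pM2r // leNgt hb.
Qed.

Lemma twisted_escape (s : R) : 0 < s < d%:R ->
  exists2 C : R, 0 < C & forall (U : nat -> set 'rV[R]_n) (w : nat -> R),
    (forall i, 0 < w i) ->
    (forall i x x', U i x -> U i x' -> `|x - x'| `^ s <= w i) ->
    (\sum_(0 <= i <oo) (w i)%:E <= C%:E)%E ->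
    exists y, [/\ cube u0 a y, (\bigcap_t Bad_twisted Theta (k t)) (g y) &
                  forall i, ~ U i (g y)].
Proof.
move=> /andP[s0 sd]; have ds0 : 0 < d%:R - s by rewrite subr_gt0.
(* The first two summands give the bound required by [card_slab]; the third gives
   [2 * 2 ^ d <= r ^ (d - s)], which is where [s < d] enters. *)
pose B := (2 + L) / delta + 1 + (2 * 2 ^ d)%:R `^ (d%:R - s)^-1.
have [b hb] : exists b : nat, B < b%:R.
  by exists (Num.truncn B).+1; rewrite truncnS_gt.
have A0 : 0 <= (2 * 2 ^ d)%:R `^ (d%:R - s)^-1 :> R by rewrite powR_ge0.
have L2 : 0 < (2 + L) / delta by rewrite divr_gt0 // addr_gt0.
have b0' : 0 < b%:R :> R by apply: le_lt_trans hb; rewrite !addr_ge0 // ltW.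
have b0 : (0 < b)%N by rewrite ltr0n in b0'.
have hb1 : 2 + L < delta * (b%:R - 1).
  by rewrite -ltr_pdivrMl // mulrC; rewrite /B in hb; lra.
set r := (b + b)%N.
have r1 : (1 < r)%N by exact: (leq_add b0 b0).
have r0 : 0 < r%:R :> R by rewrite ltr0n ltnW.
pose theta := (r%:R^-1 : R) `^ s.
have thN N : theta ^+ N = (r%:R^-1 ^+ N) `^ s.
  by rewrite /theta -powR_mulrn ?powR_ge0 // -powRrM mulrC powRrM powR_mulrn //.
(* A piece of weight at most [C theta ^ N] has diameter at most [a / (2 Lam r ^ (N + 1))], so its
   preimage under [g] has diameter at most half the side of the cells of the next step. *)
pose C := (a / (2 * Lam * r%:R)) `^ s.
have C0 : 0 < C by rewrite powR_gt0 // divr_gt0 // !mulr_gt0.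
exists C => // U w w0 Uw wC.
have [Good [strat hGood]] := twisted_strategy r1.
pose V i := cube u0 a `&` g @^-1` (U i).
have [||||||y [cy Gy Vy]] := @cantor_escape R d b u0 a C theta V w Good b0 a_gt0 C0.
- apply/andP; split; first by rewrite powR_gt0 // invr_gt0.
  have := gt0_ltr_powR s0 (x := r%:R^-1) (y := 1); rewrite powR1; apply.
  + by rewrite nnegrE invr_ge0.
  + by rewrite nnegrE.
  + by rewrite invf_lt1 // ltr1n.
- have -> : theta * r%:R ^+ d = r%:R `^ (d%:R - s).
    rewrite /theta -powR_inv1 ?(ltW r0) // -powRrM mulN1r -powR_mulrn ?(ltW r0) //.
    by rewrite -powRD ?(gt_eqF r0) ?implybT // addrC.
  rewrite -[leLHS]powRr1 // -[X in _ `^ X <= _](mulVf (lt0r_neq0 ds0)) powRrM.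
  apply: (ge0_ler_powR (ltW ds0)); [by rewrite nnegrE|by rewrite nnegrE ltW|].
  apply: le_trans (_ : b%:R <= _); last by rewrite ler_nat leq_addr.
  by apply: le_trans (ltW hb); rewrite lerDr addr_ge0 // ltW.
- exact: w0.
- exact: wC.
- move=> i N wi y y' [cy Uy] [cy' Uy'] j.
  have h : `|g y - g y'| `^ s <= (a / (2 * Lam * r%:R) * r%:R^-1 ^+ N) `^ s.
    rewrite powRM ?exprn_ge0 ?invr_ge0 ?(ltW r0) //; last first.
      by rewrite ltW // divr_gt0 // !mulr_gt0.
    by rewrite -thN; apply: le_trans wi; exact: (Uw i).
  have h2 : `|g y - g y'| <= a / (2 * Lam * r%:R) * r%:R^-1 ^+ N.
    rewrite leNgt; apply/negP => h2.
    have := gt0_ltr_powR s0 _ _ h2; rewrite !nnegrE ltNge h normr_ge0 => /(_ _ isT).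
    rewrite mulr_ge0 ?exprn_ge0 ?invr_ge0 ?(ltW r0) //; first by move=> /(_ isT).
    by rewrite ltW // divr_gt0 // !mulr_gt0.
  apply: le_lt_trans (g_expand cy cy' j) _.
  apply: le_lt_trans (ler_wpM2l (ltW Lam_gt0) h2) _.
  have -> : Lam * (a / (2 * Lam * r%:R) * r%:R^-1 ^+ N) = 2^-1 * (a / r%:R ^+ N.+1).
    by rewrite exprVn exprS; field; rewrite expf_neq0 !gt_eqF.
  have : 0 < a / r%:R ^+ N.+1 by rewrite divr_gt0 // exprn_gt0.
  by rewrite -/r; lra.
- move=> N u sub; have [i [c0 hc0]] := strat N u sub.
  exists (fun k : {ffun 'I_d -> 'I_r} => `[< exists2 y, subcube u (a / r%:R ^+ N.+1) k y &
          `|g y 0 i - c0| <= a / r%:R ^+ N.+1 >]); split; first exact: card_slab.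
  move=> k' y /asboolPn hk sy; apply: hc0.
    rewrite (_ : a / r%:R ^+ N = r%:R * (a / r%:R ^+ N.+1)).
      by apply: subcube_sub sy; rewrite ltW // divr_gt0 // exprn_gt0.
    by rewrite exprS invfM mulrCA mulVKf ?gt_eqF.
  by rewrite ltNge; apply/negP => h; apply: hk; exists y.
exists y; split=> // [|i Uy]; first exact: hGood.
by apply: (Vy i).
Qed.

End twisted_game.
(** * Hausdorff dimension *)

Section hausdorff_lemmas.
Context {R : realType} {V : normedModType R}.
Implicit Types (X Y : set V) (U : nat -> set V).
Local Open Scope ereal_scope.

Lemma hausdorff_gauge_ge0 (s : R) X : 0 <= hausdorff_gauge s X.
Proof. by rewrite /hausdorff_gauge; case: ifP => // _; exact: poweR_ge0. Qed.

Lemma diameter_le X (c : R) :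
  (forall x y, X x -> X y -> (`|x - y| <= c)%R) -> diameter X <= c%:E.
Proof.
by move=> h; apply: ge_ereal_sup => _ [x [y [Xx Xy ->]]]; rewrite lee_fin h.
Qed.

Lemma diameter_ge X x y : X x -> X y -> `|x - y|%:E <= diameter X.
Proof. by move=> Xx Xy; apply: ereal_sup_ubound; exists x, y. Qed.

Lemma hausdorff_gauge_ge (s : R) X x y : (0 <= s)%R -> X x -> X y ->
  (`|x - y| `^ s)%:E <= hausdorff_gauge s X.
Proof.
move=> s0 Xx Xy; rewrite /hausdorff_gauge; case: eqP => [X0|_].
  by exfalso; rewrite X0 in Xx.
rewrite -poweR_EFin gt0_ler_poweR //; last exact: diameter_ge.
  by rewrite in_itv /= lee_fin normr_ge0 leey.
by rewrite in_itv /= leey (le_trans _ (diameter_ge Xx Xy)) // lee_fin.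
Qed.

Lemma hausdorff_gauge_le (s c : R) X : (0 <= s)%R -> (0 <= c)%R ->
  (forall x y, X x -> X y -> (`|x - y| <= c)%R) ->
  hausdorff_gauge s X <= (c `^ s)%:E.
Proof.
move=> s0 c0 h; rewrite /hausdorff_gauge; case: eqP => [_|X0].
  by rewrite lee_fin powR_ge0.
have /set0P[x Xx] : X != set0 by apply/eqP.
have d0 : 0 <= diameter X by apply: le_trans (diameter_ge Xx Xx); rewrite lee_fin.
rewrite -poweR_EFin gt0_ler_poweR //; last exact: diameter_le.
  by rewrite in_itv /= leey andbT.
by rewrite in_itv /= lee_fin c0 leey.
Qed.

Definition small_covers (s : R) X := forall delta eta : R,
  (0 < delta)%R -> (0 < eta)%R -> exists U,
  [/\ X `<=` \bigcup_i U i, forall i, diameter (U i) <= delta%:E &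
      \sum_(0 <= i <oo) hausdorff_gauge s (U i) <= eta%:E].

Lemma hausdorff_measure_eq0P (s : R) X :
  hausdorff_measure s X = 0 <-> small_covers s X.
Proof.
split=> [h0 delta eta d0 e0|h].
  have : hausdorff_premeasure s delta X < eta%:E.
    apply: (@le_lt_trans _ _ 0); last by rewrite lte_fin.
    by rewrite -h0; apply: ereal_sup_ubound; exists delta.
  by move=> /ereal_inf_lt[_ [U [XU dU] <-]] /ltW hU; exists U.
apply/eqP; rewrite eq_le; apply/andP; split.
  apply: ge_ereal_sup => _ [delta /= d0 <-]; apply/lee_addgt0Pr => eta e0.
  have [U [XU dU hU]] := h _ _ d0 e0; rewrite add0e; apply: le_trans hU.
  by apply: ereal_inf_lbound; exists U.
apply: (@le_trans _ _ (hausdorff_premeasure s 1 X)); last first.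
  by apply: ereal_sup_ubound; exists 1%R; first exact: ltr01.
apply: le_ereal_inf_tmp => _ [U _ <-]; apply: nneseries_ge0 => i _ _.
exact: hausdorff_gauge_ge0.
Qed.

(** The covers of the pieces get the budgets [eta / 2 ^ (i + 1)] and are merged into one sequence by
    a bijection of [nat] with [nat * nat]. *)
Lemma small_covers_bigcup (s : R) (X : nat -> set V) :
  (forall i, small_covers s (X i)) -> small_covers s (\bigcup_i X i).
Proof.
move=> hX delta eta d0 e0.
have /choice[U hU] : forall i, exists U,
    [/\ X i `<=` \bigcup_i U i, forall i, diameter (U i) <= delta%:E &
      \sum_(0 <= j <oo) hausdorff_gauge s (U j) <= (eta / (2 ^ i.+1)%:R)%:E].
  by move=> i; apply: hX => //; rewrite divr_gt0 // ltr0n expn_gt0.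
have /ppcard_eqP[f] : ([set: nat] #= [set: nat * nat])%card.
  by rewrite card_eq_sym card_nat2.
exists (fun i => U (f i).1 (f i).2); split.
- move=> x [i _ Xix]; have [h _ _] := hU i; have [j _ Ux] := h x Xix.
  have [l _ fl] := 'surj_f (I : [set: nat * nat] (i, j)).
  by exists l => //; rewrite fl.
- by move=> i; have [_ h _] := hU (f i).1.
- rewrite nneseries_esumT; last by move=> i; exact: hausdorff_gauge_ge0.
  rewrite -(reindex_esum [set: nat] [set: nat * nat] f
    (fun ij => hausdorff_gauge s (U ij.1 ij.2))); last exact: 'bij_f.
  rewrite (_ : [set: nat * nat] = [set: nat] `*`` (fun=> [set: nat])); last first.
    by apply/seteqP; split.
  rewrite -(@esum_esum _ _ _ _ (fun=> [set: nat]) (fun i j => hausdorff_gauge s (U i j))); last first.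
    by move=> *; exact: hausdorff_gauge_ge0.
  rewrite -nneseries_esumT; last first.
    by move=> i; apply: esum_ge0 => j _; exact: hausdorff_gauge_ge0.
  apply: (@le_trans _ _ (\sum_(0 <= i <oo) (eta / (2 ^ i.+1)%:R)%:E)).
    apply: lee_nneseries => i *.
      by apply: esum_ge0 => j _; exact: hausdorff_gauge_ge0.
    rewrite -nneseries_esumT; last by move=> ?; exact: hausdorff_gauge_ge0.
    by have [_ _] := hU i.
  exact: (epsilon_trick0 xpredT (ltW e0)).
Qed.

Lemma small_coversS (s : R) X Y : X `<=` Y -> small_covers s Y -> small_covers s X.
Proof.
move=> XY hY delta eta d0 e0; have [U [YU dU hU]] := hY _ _ d0 e0.
by exists U; split=> //; exact: subset_trans YU.
Qed.

Lemma small_covers_finite (s : R) X : (0 < s)%R ->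
  (forall delta eta : R, (0 < delta)%R -> (0 < eta)%R ->
     exists (T : finType) (W : T -> set V) (c : R),
     [/\ (0 <= c <= delta)%R, (#|T|%:R * c `^ s <= eta)%R,
         forall t x y, W t x -> W t y -> (`|x - y| <= c)%R &
         X `<=` \bigcup_t W t]) ->
  small_covers s X.
Proof.
move=> s0 h delta eta d0 e0; have [T [W [c [/andP[c0 cd] ce Wc XW]]]] := h _ _ d0 e0.
(* The finite cover is continued by empty sets, whose gauge is 0 for every exponent. *)
pose U i : set V := if @insub nat (fun i => i < #|T|)%N 'I_#|T| i is Some j
  then W (enum_val j) else set0.
have Uc i x y : U i x -> U i y -> (`|x - y| <= c)%R.
  by rewrite /U; case: insubP => // j _ _; exact: Wc.
exists U; split.
- move=> x /XW[t _ Wtx]; exists (enum_rank t : nat) => //.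
  by rewrite /U insubT // => h'; rewrite (_ : Sub _ _ = enum_rank t) ?enum_rankK //; exact: val_inj.
- move=> i; apply: (@le_trans _ _ c%:E); last by rewrite lee_fin.
  by apply: diameter_le; exact: Uc.
- rewrite (nneseries_split 0 #|T|); last by move=> *; exact: hausdorff_gauge_ge0.
  rewrite eseries0 ?adde0; last first.
    move=> i; rewrite add0n /= => iT _; rewrite /U insubF /hausdorff_gauge ?eqxx //.
    by rewrite ltnNge iT.
  apply: (@le_trans _ _ (\sum_(0 <= i < 0 + #|T|) (c `^ s)%:E)).
    apply: lee_sum => i _; apply: hausdorff_gauge_le => //; first exact: ltW.
    exact: Uc.
  by rewrite sumEFin add0n big_const_nat subn0 iter_addr addr0 -mulr_natl lee_fin.
Qed.

Lemma hausdorff_dim_le X (D : R) : (0 <= D)%R ->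
  (forall s, (D < s)%R -> small_covers s X) -> hausdorff_dim X <= D%:E.
Proof.
move=> D0 h; apply/lee_addgt0Pr => e e0; apply: ereal_inf_lbound.
exists (D + e)%R => //; split; first by rewrite addr_ge0 // ltW.
by apply/hausdorff_measure_eq0P/h; rewrite ltrDl.
Qed.

(** It suffices to escape every cover of small [s]-sum for [0 < s < D]. Positive weights [w i] stand
    for the gauges, which may vanish, for instance on singletons. *)
Lemma hausdorff_dim_ge X (D : R) : (0 < D)%R ->
  (forall s, (0 < s < D)%R -> exists2 C : R, (0 < C)%R &
     forall U (w : nat -> R), (forall i, 0 < w i)%R ->
     (forall i x x', U i x -> U i x' -> (`|x - x'| `^ s <= w i)%R) ->
     \sum_(0 <= i <oo) (w i)%:E <= C%:E ->
     exists2 x, X x & forall i, ~ U i x) ->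
  D%:E <= hausdorff_dim X.
Proof.
move=> D0 h; apply: le_ereal_inf_tmp => _ [s [s0 /hausdorff_measure_eq0P hs] <-].
rewrite lee_fin leNgt; apply/negP => sD.
have pos2 (C : R) i : (0 < C -> 0 < C / 2 / (2 ^ i.+1)%:R)%R.
  by move=> C0; rewrite !divr_gt0 // ltr0n expn_gt0.
(* For [s = 0] a nonempty set has gauge 1, so a cover of sum at most [1 / 2] has only empty members;
   the exponent [D / 2] then gives a point of [X], which such a cover misses. *)
move: s0; rewrite le_eqVlt => /predU1P[s0|s0].
  have D2 : (0 < D / 2 < D)%R by apply/andP; split; lra.
  have [C C0 hC] := h _ D2.
  have half : (0 < 2^-1 :> R)%R by rewrite invr_gt0.
  have [U [XU _ hU]] := hs 1%R 2^-1%R ltr01 half.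
  have U0 i : U i = set0.
    apply: contrapT => /eqP Ui; have : 1 <= (2^-1 : R)%:E.
      apply: le_trans hU; rewrite (nneseries_split 0 i.+1); last first.
        by move=> *; exact: hausdorff_gauge_ge0.
      rewrite -[leLHS]adde0; apply: leeD; last first.
        by apply: nneseries_ge0 => *; exact: hausdorff_gauge_ge0.
      rewrite add0n big_nat_recr //= -[leLHS]add0e; apply: leeD.
        by apply: sume_ge0 => *; exact: hausdorff_gauge_ge0.
      by rewrite /hausdorff_gauge (negbTE Ui) -s0 poweRe0.
    by rewrite lee_fin; lra.
  have [|||x Xx Ux] := hC U (fun i => C / 2 / (2 ^ i.+1)%:R)%R.
  - by move=> i; exact: pos2.
  - by move=> i x x'; rewrite U0.
  - apply: le_trans (epsilon_trick0 xpredT _) _; first by rewrite divr_ge0 // ltW.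
    by rewrite lee_fin; lra.
  by have [i _ /Ux] := XU x Xx.
have [|C C0 hC] := h s; first by rewrite s0.
have C2 : (0 < C / 2)%R by rewrite divr_gt0.
have [U [XU _ hU]] := hs 1%R _ ltr01 C2.
pose G i := hausdorff_gauge s (U i).
have G0 i : 0 <= G i by exact: hausdorff_gauge_ge0.
have Gfin i : (fine (G i))%:E = G i.
  apply: fineK; rewrite ge0_fin_numE //; apply: (@le_lt_trans _ _ (C / 2)%:E); last exact: ltry.
  apply: le_trans hU; rewrite (nneseries_split 0 i.+1); last by move=> *; exact: G0.
  rewrite -[leLHS]adde0; apply: leeD; last by apply: nneseries_ge0 => *; exact: G0.
  rewrite add0n big_nat_recr //= -[leLHS]add0e; apply: leeD => //.
  by apply: sume_ge0 => *; exact: G0.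
(* Half of [C] bounds the gauges, the other half is spread geometrically to make every weight
   positive. *)
have [|||x Xx Ux] := hC U (fun i => fine (G i) + C / 2 / (2 ^ i.+1)%:R)%R.
- by move=> i; apply: ltr_wpDl (pos2 _ _ C0); rewrite -lee_fin Gfin.
- move=> i x x' Ux Ux'; rewrite -lee_fin EFinD Gfin -[leLHS]adde0; apply: leeD.
    by apply: hausdorff_gauge_ge => //; exact: ltW.
  by rewrite lee_fin ltW // pos2.
- under eq_eseriesr do rewrite EFinD Gfin.
  apply: le_trans (epsilon_trick xpredT _ _) _ => //; first exact: ltW.
  apply: le_trans (leeD hU (lexx _)) _.
  by rewrite -EFinD lee_fin; lra.
by have [i _ /Ux] := XU x Xx.
Qed.

End hausdorff_lemmas.

(** * Continuously differentiable maps and charts *)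

Lemma ballP (R : realType) (n : nat) (x y : 'rV[R]_n) (r : R) :
  ball x r y <-> `|x - y| < r.
Proof. by rewrite -ball_normE. Qed.

Lemma mx_entryB (R : realType) (p q : nat) (A B : 'M[R]_(p, q)) i j :
  (A - B) i j = A i j - B i j.
Proof. by rewrite !mxE. Qed.

Section C1_estimates.
Context {R : realType} {n : nat}.
Implicit Types (f : 'rV[R]_n -> 'rV[R]_n) (x y : 'rV[R]_n) (U : set 'rV[R]_n).

(** The one-variable mean value theorem along the segment; the intermediate point depends on the
    coordinate [i]. *)
Lemma mean_value_rV f x y (i : 'I_n) :
  (forall t : R, 0 <= t <= 1 -> differentiable f (x + t *: (y - x))) ->
  exists2 t : R, 0 <= t <= 1 &
    f y 0 i - f x 0 i = \sum_j (y - x) 0 j * jacobian f (x + t *: (y - x)) j i.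
Proof.
move=> hf; pose v := y - x; pose F (t : R) := f (x + t *: v).
have quot t : (fun h : R => h^-1 *: ((F \o shift t) (h *: (1 : R)) - F t)) =
    (fun h => h^-1 *: ((f \o shift (x + t *: v)) (h *: v) - f (x + t *: v))).
  apply/funext => h; rewrite /F /= /shift /= -[h *: 1]/(h * 1) mulr1 scalerDl.
  by rewrite addrCA.
have dF (t : R) : 0 <= t <= 1 -> derivable F t 1 /\ 'D_1 F t = v *m jacobian f (x + t *: v).
  move=> t01; have df := hf t t01; split.
    by rewrite /derivable quot; apply: diff_derivable.
  by rewrite -(deriveEjacobian v df) /derive quot.
have der (t : R) : 0 <= t <= 1 -> is_derive t 1 (fun t => F t 0 i : R)
    ((v *m jacobian f (x + t *: v)) 0 i).
  move=> t01; have [d1 d2] := dF t t01; apply: DeriveDef.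
    exact: (derivable_mxP _ _ _).1 d1 0 i.
  by have := derive_mx d1; rewrite d2 => ->; rewrite mxE.
have [||t t01 e] := @MVT_segment R (fun t : R => F t 0 i)
    (fun t : R => (v *m jacobian f (x + t *: v)) 0 i) 0 1 ler01.
- by move=> t; rewrite in_itv /= => /andP[t0 t1]; apply: der; rewrite !ltW.
- apply: derivable_within_continuous => t; rewrite in_itv /= => t01.
  by have := der t t01 => -[].
exists t; first by rewrite in_itv /= in t01.
have xv : x + v = y by rewrite addrC subrK.
by move: e; rewrite /F scale1r scale0r addr0 subr0 mulr1 xv => ->; rewrite mxE.
Qed.

Lemma ball_segment x0 x y (r t : R) : 0 <= t <= 1 ->
  ball x0 r x -> ball x0 r y -> ball x0 r (x + t *: (y - x)).
Proof.
move=> /andP[t0 t1] /ballP hx /ballP hy; apply/ballP.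
have -> : x0 - (x + t *: (y - x)) = (1 - t) *: (x0 - x) + t *: (x0 - y).
  by apply/rowP => j; rewrite !mxE; ring.
apply: le_lt_trans (ler_normD _ _) _; rewrite !normrZ !ger0_norm ?subr_ge0 //.
case: (ltrP t 1) => t1'; last first.
  have -> : t = 1 by apply/eqP; rewrite eq_le t1 t1'.
  by rewrite subrr mul0r add0r mul1r.
have h1 : (1 - t) * `|x0 - x| < (1 - t) * r by rewrite ltr_pM2l // subr_gt0.
have h2 : t * `|x0 - y| <= t * r by rewrite ler_wpM2l // ltW.
lra.
Qed.

(** Strict differentiability: the Jacobian at the fixed point [x0] serves for all pairs [x], [y]
    near it, because the Jacobian at the intermediate point of the mean value theorem is within
    [eta] of it. *)
Lemma C1_on_linear U f x0 (eta : R) : open U -> U x0 -> C1_on U f -> 0 < eta ->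
  exists2 r : R, 0 < r & ball x0 r `<=` U /\
    forall x y, ball x0 r x -> ball x0 r y -> forall i,
      `|f y 0 i - f x 0 i - \sum_j (y - x) 0 j * jacobian f x0 j i| <=
        eta * \sum_j `|(y - x) 0 j|.
Proof.
move=> oU Ux0 [df cJ] eta0.
have cJ0 : {for x0, continuous (jacobian f)}.
  by move: cJ; rewrite continuous_open_subspace // => /(_ x0); apply; rewrite inE.
have /cvgrPdist_lt /(_ eta eta0) /nbhs_ballP[r1 /= r10 hr1] := cJ0.
have /nbhs_ballP[r2 /= r20 hr2] := open_nbhs_nbhs (conj oU Ux0).
exists (Num.min r1 r2); first by rewrite lt_min r10.
have sub1 : ball x0 (Num.min r1 r2) `<=` ball x0 r1.
  by apply: le_ball; rewrite ge_min lexx.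
have sub2 : ball x0 (Num.min r1 r2) `<=` ball x0 r2.
  by apply: le_ball; rewrite ge_min lexx orbT.
split=> [|x y bx by_ i]; first exact: subset_trans hr2.
have [t t01|t t01 ->] := @mean_value_rV f x y i.
  by apply/df/hr2/sub2/ball_segment.
rewrite -sumrB mulr_sumr; apply: le_trans (ler_norm_sum _ _ _) _.
apply: ler_sum => j _; rewrite -mulrBr normrM mulrC ler_wpM2r //.
have /ltW := hr1 _ (sub1 _ (ball_segment t01 bx by_)).
by apply: le_trans; rewrite distrC -mx_entryB; exact: entry_le_norm.
Qed.

Lemma C1_on_lipschitz U f x0 : open U -> U x0 -> C1_on U f ->
  exists (K r : R), [/\ 0 < K, 0 < r, ball x0 r `<=` U &
    forall x y, ball x0 r x -> ball x0 r y -> `|f y - f x| <= K * `|y - x|].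
Proof.
move=> oU Ux0 C1f; have [r r0 [sub hr]] := C1_on_linear oU Ux0 C1f ltr01.
exists (n%:R * (1 + `|jacobian f x0|) + 1), r; split=> //.
move=> x y bx by_; apply: norm_le_entries => //.
move=> i0 i; rewrite (ord1 i0) {i0} !mxE.
have h := hr x y bx by_ i; rewrite mul1r in h.
have h1 : \sum_j `|(y - x) 0 j| <= n%:R * `|y - x|.
  rewrite mulr_natl -[X in _ *+ X]card_ord -sumr_const; apply: ler_sum => j _.
  exact: entry_le_norm.
have h2 : `|\sum_j (y - x) 0 j * jacobian f x0 j i| <= n%:R * `|y - x| * `|jacobian f x0|.
  apply: le_trans (ler_norm_sum _ _ _) _.
  apply: le_trans (ler_wpM2r (normr_ge0 _) h1); rewrite mulr_suml.
  apply: ler_sum => j _; rewrite normrM ler_wpM2l //.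
  exact: entry_le_norm.
have h3 : 0 <= `|y - x| by [].
have := ler_normD (f y 0 i - f x 0 i - \sum_j (y - x) 0 j * jacobian f x0 j i)
  (\sum_j (y - x) 0 j * jacobian f x0 j i).
rewrite subrK => h4; apply: le_trans h4 _.
apply: le_trans (lerD (le_trans h h1) h2) _.
by rewrite mulrDl mul1r mulrDr mulr1 mulrDl -addrA lerD2l mulrAC lerDl.
Qed.

(** The linear approximation is taken with [eta] equal to half the absolute value [D] of the nonzero
    entry; its error in the direction [j] is absorbed by the left-hand side, and the other
    coordinates go into [K * tau]. *)
Lemma C1_on_transverse U f x0 (i j : 'I_n) : open U -> U x0 -> C1_on U f ->
  jacobian f x0 j i != 0 ->
  exists (delta K r : R), [/\ 0 < delta, 0 < K, 0 < r, ball x0 r `<=` U &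
    forall x y, ball x0 r x -> ball x0 r y -> forall tau : R,
      (forall j', j' != j -> `|(y - x) 0 j'| <= tau) -> 0 <= tau ->
      delta * `|(y - x) 0 j| <= `|f y 0 i - f x 0 i| + K * tau].
Proof.
move=> oU Ux0 C1f Jn0; set D := `|jacobian f x0 j i|.
have D0 : 0 < D by rewrite normr_gt0.
have D20 : 0 < D / 2 by rewrite divr_gt0.
have [r r0 [sub hr]] := C1_on_linear oU Ux0 C1f D20.
exists (D / 2), (n%:R * (`|jacobian f x0| + D / 2) + 1), r; split=> //.
  by rewrite ltr_wpDl // mulr_ge0 // addr_ge0 // ltW.
move=> x y bx by_ tau htau tau0; have h := hr x y bx by_ i.
rewrite (bigD1 j) //= in h; set S := (\sum_(k < n | k != j) _ * _) in h.
rewrite (bigD1 j) //= in h; set A := (\sum_(k < n | k != j) _) in h.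
have hA : A <= n%:R * tau.
  apply: le_trans (_ : \sum_(k < n) tau <= _); last by rewrite sumr_const card_ord mulr_natl.
  rewrite [leRHS](bigD1 j) //= -[leLHS]add0r; apply: lerD => //.
  by apply: ler_sum => k kj; exact: htau.
have hS : `|S| <= A * `|jacobian f x0|.
  apply: le_trans (ler_norm_sum _ _ _) _; rewrite mulr_suml.
  apply: ler_sum => k _; rewrite normrM ler_wpM2l //; exact: entry_le_norm.
have A0 : 0 <= A by apply: sumr_ge0.
set v := (y - x) 0 j in h *.
have hv : D * `|v| = `|v * jacobian f x0 j i| by rewrite normrM mulrC.
have h5 : D * `|v| <= `|f y 0 i - f x 0 i| + `|S| + D / 2 * (`|v| + A).
  rewrite hv -[X in `|X|](_ : (f y 0 i - f x 0 i - S -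
    (f y 0 i - f x 0 i - (v * jacobian f x0 j i + S))) = _); last by ring.
  apply: le_trans (ler_normB _ _) _; apply: lerD => //; exact: ler_normB.
have J0 : 0 <= `|jacobian f x0| by [].
have h6 : A * `|jacobian f x0| <= n%:R * tau * `|jacobian f x0| by rewrite ler_wpM2r.
have h7 : D / 2 * A <= D / 2 * (n%:R * tau) by rewrite ler_wpM2l // ltW.
rewrite mulrDr in h5.
have -> : (n%:R * (`|jacobian f x0| + D / 2) + 1) * tau =
  n%:R * tau * `|jacobian f x0| + D / 2 * (n%:R * tau) + tau by ring.
lra.
Qed.

End C1_estimates.

Section charts.
Context {R : realType} {n : nat}.
Variables (M : set 'rV[R]_n) (d : nat).

Lemma flattens_inv x U (r : R) (J : {set 'I_n}) phi psi :
  flattens M d x U r J phi psi ->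
  [/\ forall y, ball (phi x) r y -> U (psi y) /\ phi (psi y) = y,
      forall y, flat d J y -> ball (phi x) r y -> M (psi y),
      forall z, M z -> U z -> flat d J (phi z) &
      forall z, U z -> psi (phi z) = z].
Proof.
move=> [[_ Ux] _ [imU phiK] _ imM].
have psiK z : U z -> psi (phi z) = z by move=> Uz; apply: phiK; rewrite inE.
split=> // [y|y fy by_|z Mz Uz].
- by rewrite -imU => -[z Uz <-]; rewrite psiK.
- have : (flat d J `&` ball (phi x) r) y by [].
  by rewrite -imM => -[z [Mz Uz] <-]; rewrite psiK.
- have : (phi @` (M `&` U)) (phi z) by exists z.
  by rewrite imM => -[].
Qed.

Lemma nearby_point (a b t e : R) : a < b -> a <= t <= b -> 0 < e ->
  exists s, [/\ a <= s <= b, s != t & `|s - t| < e].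
Proof.
move=> ab /andP[at_ tb] e0; have e20 : 0 < e / 2 by rewrite divr_gt0.
have e2 : e / 2 < e by rewrite ltr_pdivrMr // ltr_pMr // ltr1n.
have [tb'|bt] := ltP t b.
  have m0 : 0 < Num.min (e / 2) (b - t) by rewrite lt_min e20 subr_gt0.
  have m1 : Num.min (e / 2) (b - t) <= e / 2 by rewrite ge_min lexx.
  have m2 : Num.min (e / 2) (b - t) <= b - t by rewrite ge_min lexx orbT.
  exists (t + Num.min (e / 2) (b - t)); split.
  - by apply/andP; split; lra.
  - by rewrite -subr_eq0 addrC addKr gt_eqF.
  - by rewrite addrC addKr gtr0_norm //; lra.
have m0 : 0 < Num.min (e / 2) (b - a) by rewrite lt_min e20 subr_gt0.
have m1 : Num.min (e / 2) (b - a) <= e / 2 by rewrite ge_min lexx.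
have m2 : Num.min (e / 2) (b - a) <= b - a by rewrite ge_min lexx orbT.
exists (t - Num.min (e / 2) (b - a)); split.
- by apply/andP; split; lra.
- by rewrite -subr_eq0 addrC addKr oppr_eq0 gt_eqF.
- by rewrite addrC addKr normrN gtr0_norm //; lra.
Qed.

(* If the i-th row of the differential of the chart vanished, the i-th
   coordinate would be stationary along every curve in M through the point. *)
Lemma chart_transverse (f f' : R -> 'rV[R]_n) (a b t : R) (i : 'I_n)
    U (r : R) (J : {set 'I_n}) phi psi :
  a < b -> C1_path a b f f' -> f @` `[a, b]%classic `<=` M ->
  t \in `[a, b] -> f' t 0 i != 0 ->
  flattens M d (f t) U r J phi psi ->
  C1_on U phi -> C1_on (ball (phi (f t)) r) psi ->
  exists2 j : 'I_n, (j < d)%N & jacobian psi (phi (f t)) j i != 0.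
Proof.
move=> ab [df _] fM tab vi fl C1phi C1psi; have tab' := tab; rewrite in_itv /= in tab'.
have [h1 h2 h3 h4] := flattens_inv fl.
have [[oU Ut] r0 _ _ _] := fl.
apply: contrapT => hno.
have Jz (j : 'I_n) : (j < d)%N -> jacobian psi (phi (f t)) j i = 0.
  by move=> jd; apply/eqP; apply: contrapT => /negP Jn; apply: hno; exists j.
have [K [rphi [K0 rphi0 subphi lipphi]]] := C1_on_lipschitz oU Ut C1phi.
set v := f' t in vi; pose c := `|v 0 i|.
have c0 : 0 < c by rewrite normr_gt0.
have v1 : 0 < `|v| + 1 by rewrite ltr_wpDl.
(* The summand 1 pays for replacing the derivative [v] by a difference quotient [q], the rest for
   the linear approximation of [psi], as [phi] moves by at most [K |s - t| (|v| + 1)]. *)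
pose B := 1 + n%:R * K * (`|v| + 1).
have B0 : 0 < B by rewrite ltr_wpDr // !mulr_ge0 // ltW.
pose eta := Num.min 1 (c / (2 * B)).
have eta0 : 0 < eta by rewrite lt_min ltr01 divr_gt0 // mulr_gt0.
have eta1 : eta <= 1 by rewrite ge_min lexx.
have etaB : eta * B < c.
  apply: (@le_lt_trans _ _ (c / 2)); last by rewrite ltr_pdivrMr // ltr_pMr // ltr1n.
  rewrite -ler_pdivlMr // -mulrA -invfM; by rewrite ge_min lexx orbT.
have oB : open (ball (phi (f t)) r) by exact: ball_open.
have [rpsi rpsi0 [subpsi linpsi]] :=
  C1_on_linear oB (ballxx _ r0) C1psi eta0.
have /cvgrPdist_lt /(_ eta eta0) := df t tab.
rewrite near_withinE => /nbhs_ballP[e1 /= e10 he1].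
(* Parameters [s] this close to [t] have a difference quotient near [v], keep [f s] in the ball
   where [phi] is Lipschitz and [phi (f s)] in the one where [psi] is almost linear. *)
pose e := Num.min e1 (Num.min (rphi / (`|v| + 1)) (rpsi / (K * (`|v| + 1)))).
have e0 : 0 < e by rewrite !lt_min e10 !divr_gt0 // mulr_gt0.
have [s [sab st hs]] := nearby_point ab tab' e0.
move: hs; rewrite !lt_min => /and3P[s1 s2 s3].
have st0 : 0 < `|s - t| by rewrite normr_gt0 subr_eq0.
pose q := (s - t)^-1 *: (f s - f t).
have hq : `|v - q| < eta.
  apply: he1; first by rewrite -ball_normE /= distrC.
  by split=> /=; [rewrite in_itv|apply/eqP].
have qn : `|q| <= `|v| + 1.
  have := ler_normB v (v - q); rewrite subKr => h; apply: le_trans h _.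
  by rewrite lerD2l ltW // (lt_le_trans hq).
have fst : f s - f t = (s - t) *: q.
  by rewrite /q scalerA mulfV ?scale1r // subr_eq0.
have nfst : `|f s - f t| <= `|s - t| * (`|v| + 1) by rewrite fst normrZ ler_pM2l.
have bfs : ball (f t) rphi (f s).
  apply/ballP; rewrite distrC; apply: le_lt_trans nfst _.
  by rewrite -ltr_pdivlMr.
have Ufs := subphi _ bfs.
have Mfs : M (f s) by apply: fM; exists s => //=; rewrite in_itv.
have Mft : M (f t) by apply: fM; exists t => //=; rewrite in_itv.
pose D := phi (f s) - phi (f t).
have nD : `|D| <= K * `|f s - f t| by apply: lipphi => //; exact: ballxx.
have bD : ball (phi (f t)) rpsi (phi (f s)).
  apply/ballP; rewrite distrC; apply: le_lt_trans nD _.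
  apply: (@le_lt_trans _ _ (K * (`|s - t| * (`|v| + 1)))); first by rewrite ler_pM2l.
  by rewrite mulrCA -ltr_pdivlMr // mulr_gt0.
have := linpsi _ _ (ballxx _ rpsi0) bD i.
(* The linear part vanishes: for [j < d] by the assumption on the Jacobian, for [j >= d] because
   both points of the model have coordinate 0 there. *)
rewrite !h4 // big1 ?subr0 => [|j _]; last first.
  have [/Jz ->|dj] := ltnP j d; first by rewrite mulr0.
  have [z1 _] := h3 _ Mfs Ufs; have [z2 _] := h3 _ Mft Ut.
  by rewrite !mxE z1 // z2 // subrr mul0r.
have -> : f s 0 i - f t 0 i = (s - t) * q 0 i by rewrite -mx_entryB fst mxE.
have sumD : \sum_j `|D 0 j| <= n%:R * (K * (`|s - t| * (`|v| + 1))).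
  apply: (@le_trans _ _ (\sum_(j < n) `|D|)).
    by apply: ler_sum => j _; exact: entry_le_norm.
  rewrite sumr_const card_ord mulr_natl lerMn2r; apply/orP; right.
  by apply: le_trans nD _; rewrite ler_pM2l.
move=> h; have {h} := le_trans h (ler_wpM2l (ltW eta0) sumD).
rewrite normrM (_ : eta * _ = `|s - t| * (eta * (n%:R * K * (`|v| + 1)))); last by ring.
rewrite ler_pM2l // => hqi.
have hvq : `|v 0 i - q 0 i| <= eta.
  apply: le_trans (ltW hq); rewrite -mx_entryB; exact: entry_le_norm.
have : c <= eta * B.
  rewrite /c -[v 0 i](subrK (q 0 i)) /B mulrDr mulr1.
  by apply: le_trans (ler_normD _ _) _; exact: lerD.
by rewrite leNgt etaB.
Qed.

End charts.

(** * Parametrization by cubes, and coverings of charts *)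

Definition embed (R : realType) (n d : nat) (v : 'I_d -> R) : 'rV[R]_n :=
  \row_(i < n) oapp v 0 (insub (i : nat)).

Section embed.
Context {R : realType} {n d : nat}.
Implicit Types v : 'I_d -> R.

Lemma embed_lt v (i : 'I_n) (j : 'I_d) : i = j :> nat -> embed n v 0 i = v j.
Proof.
move=> ij; rewrite mxE insubT ?ij // => h /=.
by congr v; apply: val_inj.
Qed.

Lemma embed_ge v (i : 'I_n) : (d <= i)%N -> embed n v 0 i = 0.
Proof. by move=> di; rewrite mxE insubF // ltnNge di. Qed.

Lemma embed_dist v v' (tau : R) : 0 <= tau -> (forall j, `|v j - v' j| <= tau) ->
  `|embed n v - embed n v'| <= tau.
Proof.
move=> t0 h; apply: norm_le_entries => // i0 i; rewrite (ord1 i0) {i0}.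
rewrite !mxE; case: insubP => [j _ _|_] /=; first exact: h.
by rewrite subrr normr0.
Qed.

End embed.

Lemma finite_lower_bound (R : realType) (T : finType) (e : T -> R) :
  (forall i, 0 < e i) -> exists2 c : R, 0 < c & forall i, c <= e i.
Proof.
move=> e0; exists (\big[Num.min/1]_i e i); last by move=> i; exact: bigmin_le.
by apply/lt_bigmin.
Qed.

Section parametrization.
Context {R : realType} {n : nat}.
Variables (M : set 'rV[R]_n) (d : nat) (x0 : 'rV[R]_n) (U : set 'rV[R]_n) (r : R)
  (J : {set 'I_n}) (phi psi : 'rV[R]_n -> 'rV[R]_n).
Hypotheses (dn : (d <= n)%N) (Mx0 : M x0) (fl : flattens M d x0 U r J phi psi)
  (C1phi : C1_on U phi) (C1psi : C1_on (ball (phi x0) r) psi).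

(** The restriction of [psi] to a small cube of the model has all the properties that
    [twisted_escape] asks of [g]. *)
Lemma chart_parametrization :
  (forall i : 'I_n, exists2 j : 'I_n, (j < d)%N & jacobian psi (phi x0) j i != 0) ->
  exists (g : ('I_d -> R) -> 'rV[R]_n) (u0 : 'I_d -> R) (a L delta Lam : R),
    [/\ [/\ 0 < a, 0 < L, L * a <= 4^-1, 0 < delta & 0 < Lam],
        forall y, cube u0 a y -> M (g y),
        forall y y', cube u0 a y -> cube u0 a y' ->
          forall tau, 0 <= tau -> (forall j, `|y j - y' j| <= tau) ->
          forall i, `|g y 0 i - g y' 0 i| <= L * tau,
        forall i : 'I_n, exists j : 'I_d,
          forall y y', cube u0 a y -> cube u0 a y' ->
          forall tau, 0 <= tau -> (forall j', j' != j -> `|y j' - y' j'| <= tau) ->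
          delta * `|y j - y' j| <= `|g y 0 i - g y' 0 i| + L * tau &
        forall y y', cube u0 a y -> cube u0 a y' ->
          forall j, `|y j - y' j| <= Lam * `|g y - g y'|].
Proof.
move=> trans; have [h1 h2 h3 h4] := flattens_inv fl.
have [[oU Ux0] r0 _ _ _] := fl; set y0 := phi x0.
have oB : open (ball y0 r) by exact: ball_open.
have by0 := ballxx y0 r0.
have [K [rphi [K0 rphi0 subphi lipphi]]] := C1_on_lipschitz oU Ux0 C1phi.
have [L0 [r1 [L00 r10 sub1 lippsi]]] := C1_on_lipschitz oB by0 C1psi.
have /choice[j0 /choice[del /choice[Ki /choice[ri hi]]]] : forall i : 'I_n,
    exists (j : 'I_n) (delta K r' : R), (j < d)%N /\ [/\ 0 < delta, 0 < K, 0 < r',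
      ball y0 r' `<=` ball y0 r &
    forall x y, ball y0 r' x -> ball y0 r' y -> forall tau : R,
      (forall j', j' != j -> `|(y - x) 0 j'| <= tau) -> 0 <= tau ->
      delta * `|(y - x) 0 j| <= `|psi y 0 i - psi x 0 i| + K * tau].
  move=> i; have [j jd jn0] := trans i; exists j.
  by have [de [K' [r' H]]] := C1_on_transverse oB by0 C1psi jn0; exists de, K', r'.
have [delta delta0 hdelta] : exists2 c : R, 0 < c & forall i, c <= del i.
  by apply: finite_lower_bound => i; have [_ []] := hi i.
have [r2 r20 hr2] : exists2 c : R, 0 < c & forall i, c <= ri i.
  by apply: finite_lower_bound => i; have [_ []] := hi i.
have Kige0 i : 0 <= Ki i by have [_ [_ ? _ _ _]] := hi i; exact: ltW.
(* One constant serves both as Lipschitz constant of [g] and as loss in the transversality estimates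
   for all [i]. *)
pose L := L0 + \sum_i Ki i.
have L_ge0 : 0 < L by rewrite ltr_wpDr // sumr_ge0.
have L0L : L0 <= L by rewrite lerDl sumr_ge0.
have KiL i : Ki i <= L.
  by rewrite /L (bigD1 i) //= addrCA lerDl addr_ge0 ?(ltW L00) // sumr_ge0.
(* The bounds keep the cube in the balls where [psi] is Lipschitz and transverse, keep its image in
   the ball where [phi] is Lipschitz, and give [L * a <= 4^-1]. *)
pose a := Num.min (Num.min (r1 / 2) (r2 / 2)) (Num.min (rphi / (2 * L)) (4 * L)^-1).
have a0 : 0 < a by rewrite !lt_min !divr_gt0 ?mulr_gt0 //= invr_gt0 mulr_gt0.
have a1 : a < r1.
  apply: (@le_lt_trans _ _ (r1 / 2)); last by rewrite ltr_pdivrMr // ltr_pMr // ltr1n.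
  by rewrite !ge_min lexx.
have a2 : a < r2.
  apply: (@le_lt_trans _ _ (r2 / 2)); last by rewrite ltr_pdivrMr // ltr_pMr // ltr1n.
  by rewrite !ge_min lexx ?orbT.
have a3 : L * a < rphi.
  apply: (@le_lt_trans _ _ (rphi / 2)); last by rewrite ltr_pdivrMr // ltr_pMr // ltr1n.
  rewrite mulrC -ler_pdivlMr // -mulrA -invfM.
  by rewrite !ge_min lexx ?orbT.
have a4 : L * a <= 4^-1.
  rewrite mulrC -ler_pdivlMr // -invfM.
  by rewrite !ge_min lexx ?orbT.
have [y0z y0J] := h3 _ Mx0 Ux0.
(* The point [phi x0] is the lower corner of the cube, not its centre: coordinates only increase
   from it, so that the cube stays in the half-space of a boundary chart. *)
pose u0 (j : 'I_d) := y0 0 (widen_ord dn j).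
pose g (y : 'I_d -> R) := psi (embed n y).
have dist0 y : cube u0 a y -> `|embed n y - y0| <= a.
  move=> cy; apply: norm_le_entries => [|i0 i]; first exact: ltW.
  rewrite (ord1 i0) {i0} !mxE; case: insubP => [j _ ji|di] /=.
    have /andP[c1 c2] := cy j; rewrite (_ : y0 0 i = u0 j).
      by rewrite ler_norml; apply/andP; split; lra.
    by congr (y0 0 _); apply: val_inj.
  by rewrite y0z ?subrr ?normr0 ?(ltW a0) // leqNgt.
have inball y r' : a < r' -> cube u0 a y -> ball y0 r' (embed n y).
  by move=> ar cy; apply/ballP; rewrite distrC; exact: le_lt_trans (dist0 _ cy) ar.
have inflat y : cube u0 a y -> flat d J (embed n y).
  move=> cy; split=> [i di|j jJ]; first by rewrite embed_ge.
  rewrite mxE; case: insubP => [l _ lj|_] //=.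
  have /andP[c1 _] := cy l; apply: le_trans c1.
  rewrite (_ : u0 l = y0 0 j); first exact: y0J.
  by congr (y0 0 _); apply: val_inj.
have lipg y y' (tau : R) : cube u0 a y -> cube u0 a y' -> 0 <= tau ->
    (forall j, `|y j - y' j| <= tau) -> `|g y - g y'| <= L * tau.
  move=> cy cy' t0 ht.
  apply: le_trans (lippsi _ _ (inball _ _ a1 cy') (inball _ _ a1 cy)) _.
  by apply: ler_pM => //; [exact: ltW|exact: embed_dist].
have gx0 y : cube u0 a y -> ball x0 rphi (g y).
  move=> cy; apply/ballP; rewrite distrC -(h4 _ Ux0); apply: le_lt_trans a3.
  apply: le_trans (lippsi _ _ (ballxx _ r10) (inball _ _ a1 cy)) _.
  by apply: ler_pM => //; [exact: ltW|exact: dist0].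
exists g, u0, a, L, delta, K; split.
- by split.
- by move=> y cy; apply: h2; [exact: inflat|apply/sub1/inball].
- move=> y y' cy cy' tau t0 ht i; apply: le_trans (lipg _ _ _ cy cy' t0 ht).
  by have := entry_le_norm (g y - g y') 0 i; rewrite !mxE.
- move=> i; have [jd [d0 _ _ _ H]] := hi i; exists (Ordinal jd).
  move=> y y' cy cy' tau t0 ht.
  have ar : a < ri i by exact: lt_le_trans (hr2 i).
  have := H _ _ (inball _ _ ar cy') (inball _ _ ar cy) tau.
  rewrite [X in _ * `|X|]mxE [X in _ * `|_ + X|]mxE.
  rewrite !(@embed_lt _ _ _ _ _ (Ordinal jd)) // => /(_ _ t0) H'.
  apply: (@le_trans _ _ (del i * `|y (Ordinal jd) - y' (Ordinal jd)|)).
    by rewrite ler_wpM2r.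
  apply: le_trans (H' _) _; last by rewrite lerD2l ler_wpM2r.
  move=> j' jj'; rewrite !mxE; case: insubP => [l _ lj|_] /=; last by rewrite subrr normr0.
  by apply: ht; apply: contra jj' => /eqP e; apply/eqP/val_inj; rewrite /= -lj e.
(* As [phi] inverts [g] up to the embedding, its Lipschitz constant [K] can be taken for [Lam]. *)
- move=> y y' cy cy' j.
  have := lipphi _ _ (gx0 _ cy') (gx0 _ cy).
  have [_ ->] := h1 _ (sub1 _ (inball _ _ a1 cy)).
  have [_ ->] := h1 _ (sub1 _ (inball _ _ a1 cy')).
  apply: le_trans; have := entry_le_norm (embed n y - embed n y') 0 (widen_ord dn j).
  by rewrite [X in `|X| <= _]mxE [X in `|_ + X| <= _]mxE !(@embed_lt _ _ _ _ _ j).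
Qed.

(** A piece of the model is cut into [(N + 1) ^ d] cubes of side [w N], whose images by the
    Lipschitz map [psi] have diameter at most [L * w N]; the [s]-sum is of order
    [(N + 1) ^ (d - s)], which tends to 0. *)
Lemma small_covers_chart (s : R) : d%:R < s ->
  exists2 rho : R, 0 < rho & small_covers s (M `&` ball x0 rho).
Proof.
move=> ds; have [h1 h2 h3 h4] := flattens_inv fl.
have [[oU Ux0] r0 _ _ _] := fl; set y0 := phi x0.
have oB : open (ball y0 r) by exact: ball_open.
have by0 := ballxx y0 r0.
have [K [rphi [K0 rphi0 subphi lipphi]]] := C1_on_lipschitz oU Ux0 C1phi.
have [L [r1 [L0 r10 sub1 lippsi]]] := C1_on_lipschitz oB by0 C1psi.
have s0 : 0 < s by exact: le_lt_trans (ler0n _ _) ds.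
exists (Num.min rphi (r1 / K)); first by rewrite lt_min rphi0 divr_gt0.
apply: small_covers_finite => // delta eta delta0 eta0.
pose w N : R := 2 * r1 / N.+1%:R.
have w0 N : 0 < w N by rewrite divr_gt0 // mulr_gt0.
have [N [N1 N2]] : exists N, L * w N <= delta /\
    (N.+1 ^ d)%:R * (L * w N) `^ s <= eta.
  pose Q := 2 * L * r1; have Q0 : 0 < Q by rewrite !mulr_gt0.
  have sd0 : 0 < s - d%:R by rewrite subr_gt0.
  (* The two summands make the diameter at most [delta] and the sum at most [eta], respectively. *)
  pose B := Q / delta + (Q `^ s / eta) `^ (s - d%:R)^-1.
  have B1 : 0 < Q / delta by rewrite divr_gt0.
  have B2 : 0 <= (Q `^ s / eta) `^ (s - d%:R)^-1 by exact: powR_ge0.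
  exists (Num.truncn B); have := truncnS_gt B.
  set N := Num.truncn B => hN; have N0 : 0 < N.+1%:R :> R by rewrite ltr0n.
  have -> : L * w N = Q / N.+1%:R by rewrite /w /Q; field; rewrite gt_eqF.
  split.
    rewrite ler_pdivrMr // mulrC -ler_pdivrMr //.
    by apply: le_trans (ltW hN); rewrite lerDl.
  rewrite powRM ?invr_ge0 ?(ltW Q0) ?(ltW N0) // -powR_inv1 ?(ltW N0) //.
  rewrite -powRrM mulN1r natrX -powR_mulrn ?(ltW N0) // mulrCA -powRD; last first.
    by rewrite (gt_eqF N0) implybT.
  rewrite -opprB powRN ler_pdivrMr ?powR_gt0 // mulrC -ler_pdivrMr //.
  rewrite -[leLHS]powRr1; last by rewrite divr_ge0 ?powR_ge0 ?(ltW eta0).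
  rewrite -[X in _ `^ X <= _](mulVf (lt0r_neq0 sd0)) powRrM.
  apply: (ge0_ler_powR (ltW sd0)); [by rewrite nnegrE|by rewrite nnegrE ltW|].
  by apply: le_trans (ltW hN); rewrite lerDr ltW.
pose lo (j : 'I_d) := y0 0 (widen_ord dn j) - r1.
pose W (k : {ffun 'I_d -> 'I_N.+1}) : set 'rV[R]_n := [set x | exists y,
  [/\ x = psi y, ball y0 r1 y, forall i : 'I_n, (d <= i)%N -> y 0 i = 0 &
   forall j : 'I_d, lo j + (k j)%:R * w N <= y 0 (widen_ord dn j) <=
      lo j + (k j)%:R * w N + w N]].
exists {ffun 'I_d -> 'I_N.+1}, W, (L * w N); split.
- by rewrite N1 mulr_ge0 // ltW.
- by rewrite card_ffun !card_ord.
- move=> k x x' [y [-> by_ yz hy]] [y' [-> by' yz' hy']].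
  apply: le_trans (lippsi _ _ by' by_) _; rewrite ler_pM2l //.
  apply: norm_le_entries => [|i0 i]; first exact: ltW.
  rewrite (ord1 i0) {i0} !mxE; have [id|di] := ltnP i d; last first.
    by rewrite yz // yz' // subrr normr0 ltW.
  have := hy (Ordinal id); have := hy' (Ordinal id).
  rewrite (_ : widen_ord dn (Ordinal id) = i); last exact: val_inj.
  move=> /andP[? ?] /andP[? ?]; rewrite ler_norml; apply/andP; split; lra.
- move=> x [Mx bx].
  have bx' : ball x0 rphi x by apply: le_ball bx; rewrite ge_min lexx.
  have Ux := subphi _ bx'.
  have by1 : `|phi x - y0| < r1.
    apply: le_lt_trans (lipphi _ _ (ballxx _ rphi0) bx') _.
    rewrite mulrC -ltr_pdivlMr // distrC; apply: lt_le_trans (_ : Num.min rphi (r1 / K) <= _).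
      exact/ballP.
    by rewrite ge_min lexx orbT.
  pose t (j : 'I_d) := (phi x 0 (widen_ord dn j) - lo j) / w N.
  have tN j : 0 <= t j < N.+1%:R.
    have := entry_le_norm (phi x - y0) 0 (widen_ord dn j).
    rewrite !mxE => /le_lt_trans /(_ by1); rewrite ltr_norml => /andP[t1 t2].
    rewrite /t /lo; apply/andP; split; first by rewrite divr_ge0 ?(ltW (w0 N)) //; lra.
    rewrite ltr_pdivrMr // /w mulrC divfK ?pnatr_eq0 //; lra.
  have tk j : (Num.truncn (t j) < N.+1)%N.
    have /andP[t0 t1] := tN j; rewrite -(ltr_nat R); apply: le_lt_trans t1.
    by have /andP[] := truncn_itv t0.
  exists [ffun j => Ordinal (tk j)] => //; exists (phi x); split.
  + by rewrite h4.
  + by apply/ballP; rewrite distrC.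
  + by have [] := h3 _ Mx Ux.
  + move=> j; rewrite ffunE /=; have /andP[t0 _] := tN j.
    have /andP[t1 t2] := truncn_itv t0.
    have e : phi x 0 (widen_ord dn j) = lo j + t j * w N.
      by rewrite /t divfK ?gt_eqF // addrC subrK.
    rewrite e lerD2l ler_pM2r // t1 /= -(addrA (lo j)) lerD2l -[X in _ <= _ + X]mul1r -mulrDl.
    by rewrite ler_pM2r // natr1 ltW.
Qed.

End parametrization.

(** * Countable localization and conclusion *)

Lemma small_covers0 (R : realType) (V : normedModType R) (s : R) :
  small_covers s (set0 : set V).
Proof.
move=> delta eta d0 e0; exists (fun=> set0); split => // [i|].
  by apply: diameter_le => ? ? [].
by rewrite eseries0 ?lee_fin ?(ltW e0) // => i _ _; rewrite /hausdorff_gauge eqxx.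
Qed.

(** Boxes with rational centres and radii [1 / (k + 1)] form a countable family; only those that cut
    out a part of [X] with small covers are retained, and they still cover [X]. *)
Lemma small_covers_local (R : realType) (n : nat) (s : R) (X : set 'rV[R]_n) :
  (forall x, X x -> exists2 rho : R, 0 < rho & small_covers s (X `&` ball x rho)) ->
  small_covers s X.
Proof.
move=> h.
pose B (c : 'rV[rat]_n * nat) : set 'rV[R]_n :=
  [set x | forall j, `|x 0 j - ratr (c.1 0 j)| < c.2.+1%:R^-1].
pose Y i := if unpickle i is Some c then
  if `[< small_covers s (X `&` B c) >] then X `&` B c else set0 else set0.
apply: (@small_coversS _ _ _ _ (\bigcup_i Y i)); last first.
  apply: small_covers_bigcup => i; rewrite /Y.
  case: unpickle => [c|]; last exact: small_covers0.
  by case: asboolP => // _; exact: small_covers0.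
move=> x Xx; have [rho rho0 hr] := h x Xx.
pose k := Num.truncn (2 / rho).
have k0 : 0 < k.+1%:R :> R by rewrite ltr0n.
have kr : 2 * k.+1%:R^-1 < rho.
  by rewrite ltr_pdivrMr // mulrC -ltr_pdivrMr // truncnS_gt.
have /choice[q hq] : forall j : 'I_n, exists q : rat, `|x 0 j - ratr q| < k.+1%:R^-1.
  move=> j; have [|q] := @rat_in_itvoo R (x 0 j - k.+1%:R^-1) (x 0 j + k.+1%:R^-1).
    by rewrite ltrBlDr -addrA ltrDl addr_gt0 ?invr_gt0.
  by rewrite in_itv /= => qx; exists q; rewrite ltr_distlC.
pose c := (\row_j q j, k).
have Bx : B c x by move=> j; rewrite mxE.
exists (pickle c) => //; rewrite /Y pickleK; case: asboolP => // -[].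
apply: small_coversS hr => y [Xy By]; split=> //; apply/ballP.
apply: le_lt_trans kr; apply: norm_le_entries => [|i0 j].
  by rewrite mulr_ge0 // invr_ge0.
rewrite (ord1 i0) mx_entryB; have hy := By j; have hx := Bx j.
rewrite (_ : x 0 j - y 0 j = (x 0 j - ratr (c.1 0 j)) - (y 0 j - ratr (c.1 0 j))).
  by apply: le_trans (ler_normB _ _) _; rewrite mulr_natl mulr2n lerD // ltW.
by rewrite opprB addrA subrK.
Qed.

Theorem corollary2p2 (R : realType) (n m : nat) (hn : (1 <= n)%N)
    (hm : (1 <= m)%N) (k : nat -> 'I_n -> R)
    (k_gt0 : forall t i, 0 < k t i)
    (k_sum : forall t, \sum_(i < n) k t i = 1)
    (Theta : 'M[R]_(n, m)) (hTheta : (\bigcap_t Bad m (k t)) Theta)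
    (M : set 'rV[R]_n) (hM : nondegenerate_submanifold M) :
  hausdorff_dim ((\bigcap_t Bad_twisted Theta (k t)) `&` M) = hausdorff_dim M.
Proof.
have [d d0 [[dn charts] [F [UF _ leaves _]]]] := hM.
have [M0|/set0P[p Mp]] := eqVneq M set0; first by rewrite M0 setI0.
have upper X : X `<=` M -> (hausdorff_dim X <= d%:R%:E)%E.
  move=> XM; apply: hausdorff_dim_le => // s ds.
  apply: (small_coversS XM); apply: small_covers_local => x Mx.
  have [U [r [J [phi [psi [fl C1phi C1psi]]]]]] := charts x Mx.
  exact: (small_covers_chart dn fl).
have [L FL Lp] : (\bigcup_(L in F) L) p by rewrite UF.
have [C [curves _ LC]] := leaves L FL.
(* The first arc of any leaf already provides a point at which a tangent vector of [M] has only
   nonzero coordinates. *)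
have [a [b [f [f' [ab C1f Cf [t tab f'0]]]]]] := curves 0%N.
have fM : f @` `[a, b]%classic `<=` M.
  by rewrite -Cf -UF => x Cx; exists L => //; rewrite LC; exists 0%N.
have Mt : M (f t) by apply: fM; exists t.
have [U [r [J [phi [psi [fl C1phi C1psi]]]]]] := charts _ Mt.
have [g [u0 [c [K [delta [Lam [[c0 K0 Kc delta0 Lam0] gM glip gtrans gexp]]]]]]] :=
  chart_parametrization dn Mt fl C1phi C1psi
    (fun i => chart_transverse ab C1f fM tab (f'0 i) fl C1phi C1psi).
(* Stated for every set containing the intersection, so that it applies to [M] as well. *)
have lower X : (\bigcap_t Bad_twisted Theta (k t)) `&` M `<=` X ->
    (d%:R%:E <= hausdorff_dim X)%E.
  move=> AX; apply: hausdorff_dim_ge => [|s sd]; first by rewrite ltr0n.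
  have [C' C'0 hC] := twisted_escape hn hm k_gt0 k_sum hTheta c0 K0 Kc glip
    delta0 Lam0 gtrans gexp sd.
  exists C' => // V w w0 Vw wC; have [y [cy Ay Vy]] := hC V w w0 Vw wC.
  by exists (g y) => //; apply: AX; split=> //; exact: gM.
by apply/eqP; rewrite eq_le !(le_trans (upper _ _) (lower _ _)).
Qed.
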